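(* Let $r\in\mathbb{R}$ with $0<|r|<1$ and suppose the increment pairs $(\xi_n,\eta_n)$ are correlated with coefficient $r$. There exists a constant $C_{13}(\alpha, r)$ such that for all $n$ large enough, $$d_{Kol} \left( \frac{1}{1-r^2} \sqrt{\frac{1-\alpha^2}{1+\alpha^2}}\, \sqrt{n}\, (\theta_n -r), \, \mathcal{N}(0,1) \right) \leq C_{13}(\alpha, r) \, \sqrt{\frac{\ln n}{n}}.$$
   Context: Let $\alpha\in\mathbb{R}$ with $|\alpha|<1$. The pairs $(\xi_n,\eta_n)$, $n\ge1$, are i.i.d. Gaussian random vectors with mean zero and covariance matrix $\begin{pmatrix}1&r\\ r&1\end{pmatrix}$ (this is the meaning of ''correlated with coefficient $r$''). Define $X_0=Y_0=0$ and $X_n=\alpha X_{n-1}+\xi_n$, $Y_n=\alpha Y_{n-1}+\eta_n$ for $n\ge 1$. Put $Z_{11}^n=\frac1n\sum_{i=1}^n X_i^2-\frac1{n^2}\left(\sum_{i=1}^n X_i\right)^2$, $Z_{22}^n=\frac1n\sum_{i=1}^n Y_i^2-\frac1{n^2}\left(\sum_{i=1}^n Y_i\right)^2$, $Z_{12}^n=\frac1n\sum_{i=1}^n X_iY_i-\frac1{n^2}\left(\sum_{i=1}^n X_i\right)\left(\sum_{i=1}^n Y_i\right)$, and $\theta_n=Z_{12}^n/\sqrt{Z_{11}^nZ_{22}^n}$ (the empirical correlation). $d_{Kol}(X,Y)=\sup_{z\in\mathbb{R}}|P(X\le z)-P(Y\le z)|$ (Kolmogorov distance between laws); $\mathcal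 N(0,1)$ stands for a standard normal random variable. *)

(* Defs.v *)
From HB Require Import structures.
From mathcomp Require Import all_boot all_order all_algebra.
From mathcomp Require Import all_classical all_reals all_analysis.
From mathcomp Require Import measurable_realfun.

Set Implicit Arguments.
Unset Strict Implicit.
Unset Printing Implicit Defensive.

Import Order.TTheory GRing.Theory Num.Theory.
Import numFieldNormedType.Exports.

Local Open Scope classical_set_scope.
Local Open Scope ring_scope.

Section kolmogorov_distance.
Context {R : realType}.
Local Open Scope ereal_scope.

(* Set functions rather than probabilities, because [distribution] and
   [normal_prob] carry different measurable structures (with the same sets). *)
Definition dKol (mu nu : set R -> \bar R) : \bar R :=
  ereal_sup [set `|mu `]-oo, z]%classic - nu `]-oo, z]%classic| | z in [set: R]].

End kolmogorov_distance.

Section gaussian_vector.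
Context {R : realType}.

Definition row2 (z : R * R) : 'rV[R]_2 :=
  \row_(j < 2) if j == ord0 then z.1 else z.2.

(* meaningful for S symmetric positive definite *)
Definition gauss2_pdf (S : 'M[R]_2) (z : R * R) : R :=
  expR (- ((row2 z *m invmx S *m (row2 z)^T) ord0 ord0 / 2))
  / (2 * pi * Num.sqrt (\det S)).

Definition centered_gaussian2 (S : 'M[R]_2) (mu : probability (R * R)%type R) :=
  forall A : set (R * R), measurable A ->
    mu A = (\int[(@lebesgue_measure R \x @lebesgue_measure R)%E]_(z in A)
              (gauss2_pdf S z)%:E)%E.

Definition corr_mx (r : R) : 'M[R]_2 := \matrix_(i, j) if i == j then 1 else r.

End gaussian_vector.

Section random_vectors.
Context d (T : measurableType d) {R : realType}.

Definition pair_rv (X Y : T -> R) (w : T) : R * R := (X w, Y w).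

Lemma measurable_pair_rv (X Y : {mfun T >-> R}) :
  measurable_fun [set: T] (pair_rv X Y).
Proof. exact: measurable_fun_pair. Qed.

HB.instance Definition _ (X Y : {mfun T >-> R}) :=
  isMeasurableFun.Build _ _ _ _ (pair_rv X Y) (measurable_pair_rv X Y).

Definition mutually_independent d' (T' : measurableType d')
    (P : probability T R) (Z : nat -> T -> T') :=
  forall (J : seq nat) (A : nat -> set T'), uniq J ->
    (forall i, measurable (A i)) ->
    P (\big[setI/[set: T]]_(i <- J) (Z i @^-1` A i))
    = (\prod_(i <- J) P (Z i @^-1` A i))%E.

End random_vectors.

Section ar1.
Context d (T : measurableType d) {R : realType}.
Implicit Types (alpha r : R) (u X Y : nat -> T -> R) (n : nat) (w : T).

(* The innovations are indexed from 1 on; [u 0] is not used. *)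
Fixpoint ar1 alpha u n w : R :=
  if n is m.+1 then alpha * ar1 alpha u m w + u n w else 0.

Definition emp_cov X Y n w : R :=
  n%:R^-1 * (\sum_(1 <= i < n.+1) X i w * Y i w)
  - (n%:R ^+ 2)^-1 *
    ((\sum_(1 <= i < n.+1) X i w) * (\sum_(1 <= i < n.+1) Y i w)).

(* Equal to 0 where an empirical variance vanishes, since 0^-1 = 0. *)
Definition emp_corr X Y n w : R :=
  emp_cov X Y n w / Num.sqrt (emp_cov X X n w * emp_cov Y Y n w).

Definition normalized_corr alpha r (xi eta : nat -> T -> R) n w : R :=
  (1 - r ^+ 2)^-1 * Num.sqrt ((1 - alpha ^+ 2) / (1 + alpha ^+ 2))
  * Num.sqrt n%:R
  * (emp_corr (ar1 alpha xi) (ar1 alpha eta) n w - r).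

Lemma measurable_ar1 alpha (u : nat -> {mfun T >-> R}) n :
  measurable_fun [set: T] (ar1 alpha u n).
Proof.
elim: n => [|n IHn] /=; first exact: measurable_cst.
by apply: measurable_funD => //; apply: measurable_funM.
Qed.

Lemma measurable_emp_cov X Y n :
  (forall i, measurable_fun [set: T] (X i)) ->
  (forall i, measurable_fun [set: T] (Y i)) ->
  measurable_fun [set: T] (emp_cov X Y n).
Proof.
move=> mX mY; apply: measurable_funB; apply: measurable_funM => //.
  by apply: measurable_sum => i; exact: measurable_funM.
by apply: measurable_funM; exact: measurable_sum.
Qed.

Lemma measurable_sqrt_fun (f : T -> R) :
  measurable_fun [set: T] f ->
  measurable_fun [set: T] (fun w => Num.sqrt (f w)).
Proof.
move=> mf; apply: (measurableT_comp (f := @Num.sqrt R)) => //.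
by apply: continuous_measurable_fun; exact: sqrt_continuous.
Qed.

Lemma measurable_inv_fun (f : T -> R) :
  measurable_fun [set: T] f -> measurable_fun [set: T] (fun w => (f w)^-1).
Proof.
move=> mf; apply: (measurableT_comp (f := @GRing.inv R)) => //.
rewrite -(setvU [set (0 : R)]).
apply/measurable_funU => //; first exact: measurableC.
split; last exact: measurable_fun_set1.
apply: open_continuous_measurable_fun.
  exact/closed_openC/closed_eq.
by move=> x; rewrite inE /= => /eqP x0; exact: inv_continuous.
Qed.

Lemma measurable_normalized_corr alpha r (xi eta : nat -> {mfun T >-> R}) n :
  measurable_fun [set: T] (normalized_corr alpha r xi eta n).
Proof.
have mX := measurable_ar1 alpha xi; have mY := measurable_ar1 alpha eta.
apply: measurable_funM => //; apply: measurable_funB => //.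
apply: measurable_funM; first exact: measurable_emp_cov.
apply: measurable_inv_fun.
by apply: measurable_sqrt_fun; apply: measurable_funM; exact: measurable_emp_cov.
Qed.

HB.instance Definition _ alpha r (xi eta : nat -> {mfun T >-> R}) n :=
  isMeasurableFun.Build _ _ _ _ (normalized_corr alpha r xi eta n)
    (measurable_normalized_corr alpha r xi eta n).

End ar1.

(* Main.v *)
(* The three empirical covariances are quadratic forms xi S xi, xi S eta, eta S eta
   in the innovations.  On the event that both empirical variances exceed half their
   limit, which fails with probability O(1/sqrt n), {theta <= c} is sandwiched between
   two events {F <= z}, where F is a polynomial of degree 4 in the innovations: the
   second-chaos linearization of theta, plus z times the relative fluctuation of the
   variances, plus a multiple of the squared difference of the variances (which comes
   from replacing the geometric by the arithmetic mean of the variances).  Gaussian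
   integration by parts gives E[F f(F)] = E[f'(F) g] + O((1 + |z|)/sqrt n) for the
   solution f of Stein's equation, with g a quadratic form concentrated around 1, so
   that the Kolmogorov distance at z is O((1 + |z|)/sqrt n); the variance of g and all
   remainders only require traces of S, S^2 and S^4.  For |z| <= sqrt (ln n) this is
   the claimed rate, and beyond that both distribution functions are within
   O(sqrt (ln n / n)) of 0 or 1 by monotonicity. *)
Require Import Defs.
From HB Require Import structures.
From mathcomp Require Import all_boot all_order all_algebra.
From mathcomp Require Import all_classical all_reals all_analysis.
From mathcomp Require Import measurable_realfun ring lra.

Set Implicit Arguments.
Unset Strict Implicit.
Unset Printing Implicit Defensive.

Import Order.TTheory GRing.Theory Num.Theory.
Import numFieldNormedType.Exports.

Local Open Scope classical_set_scope.
Local Open Scope ring_scope.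

(** * Integrating out one of finitely many independent variables *)

(** The event {theta <= c} constrains a quotient, to which integration by parts does not apply
    directly. Keeping the threshold [z] inside F turns it into a polynomial inequality, at the price
    of a bound that grows linearly in |z|; this growth is the origin of the logarithm. The linear
    part is the form Z12 - (r/2)(Z11 + Z22): it is centred, and when it is integrated by parts all
    trace terms cancel, leaving (1 - r^2)/2 times the derivative along the field (xi, eta) -> (S
    eta, S xi). The flow of this field preserves Z11 - Z22, so the squared difference does not enter
    g; it only counts through its mean O(1/n), multiplied by sqrt n. Stein's equation is used
    through f and f' alone, and both are bounded uniformly over the continuous test functions with
    values in [0, 1]. Indicators can therefore be smoothed by ramps of width 1/sqrt n, whatever
    their slope. *)

Definition update (I : eqType) (V : Type) (c : I -> V) (i : I) (v : V) : I -> V :=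
  fun j => if j == i then v else c j.

(* Stated for all measurable families at once, so that no sigma-algebra on
   [I -> V] is needed. *)
Definition measurable_functional (R : realType) (I : Type) d0 (V : measurableType d0)
    (phi : (I -> V) -> R) :=
  forall d (T : measurableType d) (z : I -> T -> V),
    (forall i, measurable_fun [set: T] (z i)) ->
    measurable_fun [set: T] (fun w => phi (z ^~ w)).

Section independence.
Context d (T : measurableType d) {R : realType} (P : probability T R).
Context d0 (V : measurableType d0) (n : nat) (Z : 'I_n -> {mfun T >-> V}).
Hypothesis indep : forall A : 'I_n -> set V, (forall i, measurable (A i)) ->
  P (\big[setI/[set: T]]_i (Z i @^-1` A i)) = (\prod_i P (Z i @^-1` A i))%E.

(** A pi-system generating the sigma-algebra of the variables other than [Z i]. *)
Let cyl (i : 'I_n) : set (set T) :=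
  [set E | exists2 A : 'I_n -> set V, (forall j, measurable (A j)) &
     E = \big[setI/[set: T]]_(j | j != i) (Z j @^-1` A j)].

Let mpre j (A : set V) : measurable A -> measurable (Z j @^-1` A).
Proof. by move=> mA; rewrite -[X in measurable X]setTI; exact: measurable_funP. Qed.

Let mcyl i : cyl i `<=` measurable.
Proof.
move=> _ [A mA ->]; elim/big_ind : _ => //; first exact: measurableI.
by move=> j _; exact: mpre.
Qed.

Let cylT i : cyl i setT.
Proof.
exists (fun=> setT) => //; rewrite big1// => j _; exact: preimage_setT.
Qed.

Let cylI i : setI_closed (cyl i).
Proof.
move=> _ _ [A mA ->] [B mB ->]; exists (fun j => A j `&` B j).
  by move=> j; exact: measurableI.
by rewrite -big_split/=; apply: eq_bigr => j _; rewrite preimage_setI.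
Qed.

Let cyl_indep i A E : measurable A -> cyl i E ->
  P (E `&` (Z i @^-1` A)) = (P (Z i @^-1` A) * P E)%E.
Proof.
move=> mA [B mB ->].
have h C : measurable C ->
    P (Z i @^-1` C `&` \big[setI/[set: T]]_(j | j != i) (Z j @^-1` B j)) =
    (P (Z i @^-1` C) * \prod_(j | j != i) P (Z j @^-1` B j))%E.
  move=> mC; transitivity (P (\big[setI/[set: T]]_j
      (Z j @^-1` (if j == i then C else B j)))).
    congr (P _); rewrite [RHS](bigD1 i)//= eqxx; congr (_ `&` _).
    by apply: eq_bigr => j /negbTE->.
  rewrite indep; last by move=> j; case: ifP.
  rewrite (bigD1 i)//= eqxx; congr (_ * _)%E.
  by apply: eq_bigr => j /negbTE->.
rewrite setIC h//; congr (_ * _)%E.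
by have := h _ measurableT; rewrite preimage_setT setTI probability_setT mul1e.
Qed.

(** Both sides are finite measures in [E] that agree on the pi-system of cylinders, hence on the
    sigma-algebra it generates. *)
Let sub_indep i A E : measurable A -> <<s cyl i >> E ->
  P (E `&` (Z i @^-1` A)) = (P (Z i @^-1` A) * P E)%E.
Proof.
move=> mA.
have pfin : P (Z i @^-1` A) \is a fin_num by apply: fin_num_measure; exact: mpre.
have r0 : 0 <= fine (P (Z i @^-1` A)) by rewrite fine_ge0.
have rE B : mscale (NngNum r0) P B = (P (Z i @^-1` A) * P B)%E.
  by rewrite /mscale /= fineK.
rewrite -rE => sE.
apply: (@g_sigma_algebra_measure_unique _ _ _ (cyl i) (@mcyl i) (fun=> setT)
  (fun=> @cylT i) _ (mrestr P (mpre i mA)) (mscale (NngNum r0) P) (@cylI i)) sE.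
- by rewrite bigcup_const//; exists 0%N.
- by move=> B cB; rewrite [RHS]rE; exact: cyl_indep.
- move=> _; change (P (setT `&` (Z i @^-1` A)) < +oo)%E.
  by rewrite setTI ltey_eq pfin.
Qed.

(** The same points with the coarser sigma-algebra of the other variables. The identity into this
    space carries all of them at once, and independence says that its joint law with [Z i] is a
    product. *)
Let Tg i : measurableType (cyl i).-sigma := g_sigma_algebraType (cyl i).

Let toTg i : T -> Tg i := id.

Let mtoTg i : measurable_fun setT (@toTg i).
Proof.
move=> _ A mA; rewrite setTI.
exact: (smallest_sub (@sigma_algebra_measurable _ T) (@mcyl i)).
Qed.

Let mZg i j : j != i -> measurable_fun [set: Tg i] (Z j : Tg i -> V).
Proof.
move=> ji _ A mA; rewrite setTI; apply: sub_sigma_algebra.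
exists (fun k => if k == j then A else setT).
  by move=> k; case: ifP.
rewrite (bigD1 j)//= eqxx big1 ?setIT// => k /andP[_ /negbTE->].
by rewrite preimage_setT.
Qed.

HB.instance Definition _ i := isMeasurableFun.Build _ _ _ _ (@toTg i) (@mtoTg i).

Let pairg i (w : T) : V * Tg i := (Z i w, toTg i w).
Let mpairg i : measurable_fun setT (@pairg i).
Proof. exact: measurable_fun_pair. Qed.
HB.instance Definition _ i := isMeasurableFun.Build _ _ _ _ (@pairg i) (@mpairg i).

(** Under the product law of [Z i] and the remaining variables, Fubini's theorem integrates over
    [Z i] first, with the others frozen; this inner integral is 0 by assumption. *)
Lemma integral_indep_eq0 (i : 'I_n) (phi : ('I_n -> V) -> R) :
  measurable_functional phi ->
  P.-integrable setT (fun w => (phi (fun j => Z j w))%:E) ->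
  (forall c, \int[distribution P (Z i)]_z (phi (update c i z))%:E = 0)%E ->
  (\int[P]_w (phi (fun j => Z j w))%:E = 0)%E.
Proof.
move=> mphi iphi phi0.
pose Phi (zw : V * Tg i) : \bar R := (phi (update (fun j => Z j zw.2) i zw.1))%:E.
have PhiE w : (phi (fun j => Z j w))%:E = Phi (pairg i w).
  rewrite /Phi /=; congr (phi _)%:E; apply/funext => j; rewrite /update.
  by case: eqP => // ->.
have mPhi : measurable_fun [set: V * Tg i] Phi.
  apply/measurable_EFinP.
  apply: (mphi _ _ (fun j (zw : V * Tg i) => if j == i then zw.1 else Z j zw.2)).
  move=> j; case: (eqVneq j i) => [_|ji]; first exact: measurable_fst.
  exact: (measurableT_comp (mZg ji) measurable_snd).
have distE : forall X, measurable X ->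
    (distribution P (Z i) \x distribution P (@toTg i))%E X = distribution P (@pairg i) X.
  apply: product_measure_unique => A B mA mB.
  rewrite /distribution /pushforward /=.
  rewrite -sub_indep//; congr (P _).
  by apply/seteqP; split => w /=; rewrite /toTg; [case|case].
have iPhi : (distribution P (@pairg i)).-integrable setT Phi.
  apply/integrableP; split => //.
  rewrite ge0_integral_distribution//.
  by move: iphi; rewrite (funext PhiE) => /integrableP[].
  exact: measurableT_comp.
rewrite (funext PhiE).
rewrite -(@integral_distribution _ _ _ _ _ P (@pairg i) Phi)//; last first.
  by move: iphi; rewrite (funext PhiE).
have -> : (\int[distribution P (@pairg i)]_y Phi y =
   \int[(distribution P (Z i) \x distribution P (@toTg i))%E]_y Phi y)%E.
  by apply: eq_measure_integral => A mA _; first [exact: distE | exact/esym/distE].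
rewrite -integral21_prod_meas1.
  rewrite (_ : fubini_G _ _ = cst 0%E) ?integral0//.
  by apply/funext => w; rewrite /fubini_G /Phi /= phi0.
apply/integrableP; split => //.
move/integrableP : iPhi => [_]; congr (_ < _)%E.
by apply: eq_measure_integral => A mA _; first [exact: distE | exact/esym/distE].
Qed.

End independence.

(** * Gaussian integration by parts for a correlated pair *)

Section density.
Context d (T : measurableType d) {R : realType}.
Variables (m nu : {measure set T -> \bar R}) (p : T -> R).
Hypotheses (mp : measurable_fun [set: T] p) (p0 : forall x, 0 <= p x).
Hypothesis nuE : forall A, measurable A -> nu A = (\int[m]_(x in A) (p x)%:E)%E.

Import HBNNSimple.

(** Both sides are monotone limits along simple functions increasing to [f], and on an indicator the
    identity is [nuE]. *)
Lemma ge0_integral_density (f : T -> \bar R) :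
  measurable_fun [set: T] f -> (forall x, 0 <= f x)%E ->
  (\int[nu]_x f x = \int[m]_x (f x * (p x)%:E))%E.
Proof.
move=> mf f0; pose h := nnsfun_approx measurableT mf.
have p0E x : (0 <= (p x)%:E)%E by rewrite lee_fin.
have mpE : measurable_fun setT (EFin \o p) by exact/measurable_EFinP.
have -> : (\int[nu]_x f x = limn (fun n => \int[nu]_x (EFin \o h n) x))%E.
  have fE x : setT x -> f x = limn (EFin \o h^~ x).
    by move=> _; apply/esym/cvg_lim => //; exact: cvg_nnsfun_approx.
  under eq_integral => x _ do rewrite (fE x)//.
  apply: monotone_convergence => //.
  - by move=> n; exact/measurable_EFinP.
  - by move=> n x _; rewrite lee_fin.
  - by move=> x _ a b ab; rewrite lee_fin; exact/lefP/nd_nnsfun_approx.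
have -> : (\int[m]_x (f x * (p x)%:E) =
    limn (fun n => \int[m]_x ((EFin \o h n) x * (p x)%:E)))%E.
  have fE x : setT x -> (f x * (p x)%:E = limn (fun n => (EFin \o h n) x * (p x)%:E))%E.
    move=> _; apply/esym/cvg_lim => //.
    apply: cvgeZr => //; exact: cvg_nnsfun_approx.
  under eq_integral => x _ do rewrite (fE x)//.
  apply: monotone_convergence => //.
  - by move=> n; apply: emeasurable_funM => //; exact/measurable_EFinP.
  - by move=> n x _; rewrite mule_ge0// lee_fin.
  - by move=> x _ a b ab; rewrite lee_wpmul2r// lee_fin; exact/lefP/nd_nnsfun_approx.
apply/congr_lim/funext => n.
transitivity (\int[nu]_x
   (\sum_(y \in range (h n)) (y * \1_(h n @^-1` [set y]) x)%:E))%E.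
  by apply: eq_integral => t tE; rewrite /= fimfunE -fsumEFin.
have indich r : measurable_fun setT (fun x => (r * \1_(h n @^-1` [set r]) x)%:E).
  by apply: (measurable_comp measurableT) => //; exact: measurable_funM.
rewrite ge0_integral_fsum//; last by move=> y x Ey; exact: nnfun_muleindic_ge0.
transitivity (\int[m]_x (\sum_(y \in range (h n))
    (y * \1_(h n @^-1` [set y]) x)%:E * (p x)%:E))%E; last first.
  apply: eq_integral => x _.
  rewrite -ge0_mule_fsuml => [|y]; last exact: nnfun_muleindic_ge0.
  by rewrite fsumEFin // -(fimfunE _ x).
rewrite ge0_integral_fsum//; last 2 first.
  - by move=> y; apply: emeasurable_funM.
  - by move=> k y Ey; rewrite mule_ge0// nnfun_muleindic_ge0.
apply: eq_fsbigr => r rhn.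
under eq_integral do rewrite EFinM.
rewrite integralZl_indic_nnsfun => //.
under [RHS]eq_integral do rewrite EFinM -muleA.
rewrite ge0_integralZl//.
- rewrite integral_indic//= setIT nuE//; congr (_ * _)%E.
  under [RHS]eq_integral do rewrite muleC.
  rewrite [LHS]integral_mkcond; apply: eq_integral => x _.
  by rewrite epatch_indic.
- by apply: emeasurable_funM; first exact/measurable_EFinP.
- by move=> t Et; rewrite mule_ge0 ?lee_fin.
- by move: rhn; rewrite inE => -[t _ <-]; rewrite lee_fin.
Qed.

Lemma integrable_density (f : T -> R) : measurable_fun [set: T] f ->
  m.-integrable setT (fun x => (f x * p x)%:E) -> nu.-integrable setT (EFin \o f).
Proof.
move=> mf /integrableP[_ fp]; apply/integrableP; split; first exact/measurable_EFinP.
rewrite ge0_integral_density//; last first.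
  by apply: measurableT_comp => //; exact/measurable_EFinP.
apply: le_lt_trans fp; rewrite le_eqVlt; apply/orP; left; apply/eqP.
by apply: eq_integral => x _ /=; rewrite normrM (ger0_norm (p0 x)) EFinM.
Qed.

Lemma integral_density (f : T -> R) : measurable_fun [set: T] f ->
  m.-integrable setT (fun x => (f x * p x)%:E) ->
  (\int[nu]_x (f x)%:E = \int[m]_x (f x * p x)%:E)%E.
Proof.
move=> mf ifp.
have mfE : measurable_fun setT (EFin \o f) by exact/measurable_EFinP.
rewrite integralE [RHS]integralE.
rewrite !ge0_integral_density//; last 2 first.
  exact: measurable_funeneg.
  exact: measurable_funepos.
congr (_ - _)%E; apply: eq_integral => x _.
  rewrite !funeposE /= -!EFin_max -EFinM; congr EFin.
  by rewrite maxr_pMl// mul0r.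
rewrite !funenegE /= -!EFin_max -EFinM; congr EFin.
by rewrite maxr_pMl// mul0r mulNr.
Qed.

End density.

(** * Functions on the line with Gaussian decay *)

Section gauss1.
Context {R : realType}.
Local Notation mu := (@lebesgue_measure R).

(** The density of the pair decays at least like exp(-x^2/4) in each coordinate, for every |r| < 1.
    Half of this exponent absorbs polynomial factors, and [gauss8] is the other half; up to a factor
    it is the normal density of standard deviation 2. *)
Definition gauss8 (x : R) : R := expR (- (x ^+ 2 / 8)).

Lemma gauss8_gt0 x : 0 < gauss8 x. Proof. exact: expR_gt0. Qed.

Lemma integrable_gauss8 : mu.-integrable setT (EFin \o gauss8).
Proof.
have := @integrable_normal_pdf R 0 2.
have h2 : (2 : R) != 0 by [].
have -> : (fun x => (normal_pdf (0 : R) 2 x)%:E) =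
   (fun x => (normal_peak (2 : R))%:E * (EFin \o gauss8) x)%E.
  apply/funext => x; rewrite normal_pdfE// -EFinM /=; congr ((_ * expR _)%:E).
  by rewrite subr0 -[_ *+ 2]mulr_natr; field.
move=> h; have := integrableZl measurableT (normal_peak (2 : R))^-1 h.
congr (integrable _ _ _); apply/funext => x /=.
by rewrite -!EFinM mulrA mulVf ?mul1r// gt_eqF// normal_peak_gt0.
Qed.

Lemma measurable_gauss8 : measurable_fun setT gauss8.
Proof. by have /integrableP[/measurable_EFinP] := integrable_gauss8. Qed.

Lemma gauss8_le (N : nat) : gauss8 N%:R <= 8 / (1 + N%:R).
Proof.
rewrite /gauss8 expRN -[leRHS]invrK lef_pV2 ?posrE ?expR_gt0 ?invr_gt0 ?divr_gt0//.
rewrite invf_div; apply: le_trans (expR_ge1Dx _).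
have : (0 : R) <= N%:R by [].
have : N%:R ^+ 2 >= N%:R :> R by rewrite -natrX ler_nat; case: N => // k; rewrite -mulnn leq_pmulr.
lra.
Qed.

(** Over [-N, N] the integral is a difference of two boundary values, which the Gaussian bound on
    [f] sends to 0; the bound on [g] gives the limit by dominated convergence. *)
Lemma integral_derive_eq0 (f g : R -> R) (C : R) :
  (forall x : R, is_derive x 1 f (g x)) -> continuous g ->
  (forall x, `|f x| <= C * gauss8 x) -> (forall x, `|g x| <= C * gauss8 x) ->
  (\int[mu]_x (g x)%:E = 0)%E.
Proof.
move=> fg cg fC gC.
have C0 : 0 <= C.
  have := le_trans (normr_ge0 _) (fC 0); rewrite pmulr_lge0//; exact: gauss8_gt0.
have mg : measurable_fun setT g by exact: continuous_measurable_fun.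
pose h n := (EFin \o g) \_ `[- n.+1%:R, n.+1%:R].
have hE n : (\int[mu]_x h n x = (f n.+1%:R)%:E - (f (- n.+1%:R))%:E)%E.
  rewrite -integral_mkcond; apply: (@continuous_FTC2 R g f).
  - by rewrite -subr_gt0 opprK addr_gt0.
  - by apply: continuous_subspaceT.
  - have cf : continuous f.
      by move=> x; apply/differentiable_continuous/derivable1_diffP; have [] := fg x.
    by split => [x _||]; [have [] := fg x| apply: cvg_at_right_filter; exact: cf | apply: cvg_at_left_filter; exact: cf].
  - by move=> x _; rewrite derive1E; exact: (@derive_val _ _ _ _ _ _ _ (fg x)).
have ig : mu.-integrable setT (fun x => (C * gauss8 x)%:E).
  exact: (integrableZl measurableT C integrable_gauss8).
have [||||_ _] := @dominated_convergence _ _ _ mu setT measurableT h (EFin \o g)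
    (fun x => (C * gauss8 x)%:E) _ _ _ ig _.
- move=> n; rewrite /h; apply/(measurable_restrictT (EFin \o g)) => //; apply: measurable_funTS.
  exact/measurable_EFinP.
- exact/measurable_EFinP.
- apply: aeW => x _; apply: cvg_near_cst.
  near=> n; rewrite /h patchE ifT// inE/= in_itv/= -ler_norml.
  near: n; exists (Num.trunc `|x|).+1 => // n /= xn.
  apply: (le_trans (ltW (truncnS_gt _))); rewrite ler_nat; exact: (leq_trans xn).
- apply: aeW => x n _; rewrite /h patchE; case: ifP => _.
    by rewrite lee_fin.
  by rewrite abse0 lee_fin mulr_ge0// ltW// gauss8_gt0.
move=> hcvg; apply: (cvg_unique _ hcvg) => //.
rewrite (_ : (fun n => _) = (fun n => (f n.+1%:R - f (- n.+1%:R))%:E)); last first.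
  by apply/funext => n; rewrite hE.
apply: cvg_EFin; first exact: nearW.
apply/(@cvgrPdist_le _ R^o) => e e0; near=> n.
rewrite /= sub0r normrN (le_trans (ler_normB _ _))//.
apply: (@le_trans _ _ (2 * (C * gauss8 n.+1%:R))).
  rewrite mulrDl mul1r lerD//.
  by apply: le_trans (fC _) _; rewrite /gauss8 sqrrN.
apply: (@le_trans _ _ (2 * (C * (8 / (1 + n.+1%:R))))).
  by rewrite !ler_wpM2l// gauss8_le.
rewrite !mulrA ler_pdivrMr//.
have e1 : (2 * C * 8) / e <= n%:R by near: n; exact: nbhs_infty_ger.
have : 2 * C * 8 <= n%:R * e by rewrite -ler_pdivrMr.
rewrite -natr1; nra.
Unshelve. all: by end_near. Qed.

End gauss1.

(** * The bivariate normal density against polynomial growth *)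

Section gauss2.
Context {R : realType}.
Local Notation mu := (@lebesgue_measure R).
Variable r : R.
Hypothesis r1 : `|r| < 1.

Let r2 : 0 < 1 - r ^+ 2.
Proof. by rewrite subr_gt0 -real_normK ?num_real// expr_lt1. Qed.

Lemma det_corr_mx : \det (corr_mx r) = 1 - r ^+ 2.
Proof.
rewrite (expand_det_row _ ord0) !big_ord_recl big_ord0 /cofactor !det_mx11 !mxE/=.
by rewrite /bump/=; ring.
Qed.

Lemma invmx_corr_mx : invmx (corr_mx r) = (1 - r ^+ 2)^-1 *: corr_mx (- r).
Proof.
have h : corr_mx r *m ((1 - r ^+ 2)^-1 *: corr_mx (- r)) = 1%:M.
  apply/matrixP => i j; rewrite !mxE !big_ord_recl big_ord0/= !mxE.
  case: i => -[|[|//]] /= ? ; case: j => -[|[|//]] /= ?; field; by rewrite gt_eqF.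
by have [u _] := mulmx1_unit h; rewrite -[LHS]mulmx1 -h mulKmx.
Qed.

Definition corr_pdf (z : R * R) : R :=
  expR (- ((z.1 ^+ 2 - 2 * r * z.1 * z.2 + z.2 ^+ 2) / (2 * (1 - r ^+ 2))))
  / (2 * pi * Num.sqrt (1 - r ^+ 2)).

Lemma gauss2_pdfE : gauss2_pdf (corr_mx r) = corr_pdf.
Proof.
apply/funext => -[x y]; rewrite /gauss2_pdf /corr_pdf det_corr_mx invmx_corr_mx.
congr (expR (- _) / _).
rewrite -scalemxAr -scalemxAl !mxE !big_ord_recl big_ord0/= !mxE !big_ord_recl !big_ord0/= !mxE/=.
by field; rewrite gt_eqF.
Qed.

Lemma corr_pdf_ge0 z : 0 <= corr_pdf z.
Proof. by rewrite divr_ge0 ?expR_ge0// !mulr_ge0 ?pi_ge0. Qed.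

Let K : R := (2 * pi * Num.sqrt (1 - r ^+ 2))^-1.
Let K0 : 0 <= K. Proof. by rewrite invr_ge0 !mulr_ge0 ?pi_ge0. Qed.

(** The eigenvalues 1 + r and 1 - r of the correlation matrix are below 2, so the inverse matrix is
    at least 1/2. The two squares below are taken along the eigenvectors. *)
Lemma corr_pdf_le z :
  corr_pdf z <= K * expR (- ((z.1 ^+ 2 + z.2 ^+ 2) / 4)).
Proof.
rewrite /corr_pdf -/K mulrC ler_wpM2l// ler_expR lerN2.
rewrite ler_pdivlMr ?mulr_gt0// mulrAC ler_pdivrMr//.
have := sqr_ge0 ((1 + r) * (z.1 - z.2)).
have := sqr_ge0 ((1 - r) * (z.1 + z.2)).
nra.
Qed.

Definition poly_growth2 (f : R * R -> R) :=
  exists C m, forall z, `|f z| <= C * (1 + z.1 ^+ 2 + z.2 ^+ 2) ^+ m.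

(** With N = m + 1, 1 + t <= 8 N (1 + t / (8 N)) <= 8 N exp (t / (8 N)), and the N-th power is
    taken. Passing from m to m + 1 avoids a division by 0. *)
Lemma expr_le_expR (m : nat) : exists2 C : R, 0 <= C &
  forall t, 0 <= t -> (1 + t) ^+ m <= C * expR (t / 8).
Proof.
exists ((8 * m.+1%:R) ^+ m.+1); first by rewrite exprn_ge0.
move=> t t0; have m0 : (0 : R) < m.+1%:R by [].
have m1 : (1 : R) <= m.+1%:R by rewrite ler1n.
apply: (@le_trans _ _ ((1 + t) ^+ m.+1)).
  by apply: ler_weXn2l => //; rewrite lerDl.
have -> : expR (t / 8) = expR (t / (8 * m.+1%:R)) ^+ m.+1.
  rewrite -expRM_natl; congr expR; field.
  by rewrite gt_eqF.
rewrite -exprMn lerXn2r// ?nnegrE ?addr_ge0 ?mulr_ge0 ?expR_ge0//.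
apply: (@le_trans _ _ (8 * m.+1%:R * (1 + t / (8 * m.+1%:R)))).
  have -> : 8 * m.+1%:R * (1 + t / (8 * m.+1%:R)) = 8 * m.+1%:R + t.
    by field; rewrite gt_eqF.
  lra.
by rewrite ler_wpM2l ?mulr_ge0// expR_ge1Dx.
Qed.

Lemma poly_growth2_gauss f : poly_growth2 f ->
  exists2 C : R, 0 <= C & forall z, `|f z * corr_pdf z| <= C * (gauss8 z.1 * gauss8 z.2).
Proof.
move=> [C [m fC]]; have [D D0 hD] := expr_le_expR m.
exists (`|C| * D * K); first by rewrite !mulr_ge0.
move=> z; rewrite normrM (ger0_norm (corr_pdf_ge0 z)).
have t0 : 0 <= z.1 ^+ 2 + z.2 ^+ 2 by rewrite addr_ge0 ?sqr_ge0.
apply: (@le_trans _ _ (`|C| * (D * expR ((z.1 ^+ 2 + z.2 ^+ 2) / 8)) *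
    (K * expR (- ((z.1 ^+ 2 + z.2 ^+ 2) / 4))))).
  apply: ler_pM => //; [exact: corr_pdf_ge0| |exact: corr_pdf_le].
  apply: (le_trans (fC z)); rewrite -addrA.
  apply: (@le_trans _ _ (`|C| * (1 + (z.1 ^+ 2 + z.2 ^+ 2)) ^+ m)).
    by rewrite ler_wpM2r ?ler_norm// exprn_ge0// addr_ge0.
  by rewrite ler_wpM2l// hD.
rewrite /gauss8 -expRD; set e1 := expR _; set e2 := expR _; set e3 := expR _.
have -> : e3 = e1 * e2 by rewrite /e1/e2/e3 -expRD; congr expR; field.
by rewrite le_eqVlt; apply/orP; left; apply/eqP; ring.
Qed.

Lemma integrable_gauss8X : (mu \x mu)%E.-integrable setT
  (fun z : R * R => (gauss8 z.1 * gauss8 z.2)%:E).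
Proof.
have mg (f : R * R -> R) : measurable_fun setT f -> measurable_fun setT (gauss8 \o f).
  by move=> mf; exact: (measurableT_comp measurable_gauss8).
have m2 : measurable_fun setT (fun z : R * R => (gauss8 z.1 * gauss8 z.2)%:E).
  by apply/measurable_EFinP; apply: measurable_funM; exact: mg.
apply/integrable12ltyP => //=.
have /integrableP[/measurable_EFinP mg8 ig] := @integrable_gauss8 R.
have mn : measurable_fun setT (fun x : R => `|gauss8 x|%:E).
  by apply/measurable_EFinP; exact: measurableT_comp.
have inner x : (\int[mu]_y `|gauss8 x * gauss8 y|%:E =
    `|gauss8 x|%:E * \int[mu]_y `|gauss8 y|%:E)%E.
  by under eq_integral => y _ do rewrite normrM EFinM; rewrite ge0_integralZl.
under eq_integral => x _ do rewrite inner.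
rewrite ge0_integralZr//; last by rewrite integral_ge0.
by rewrite lte_mul_pinfty ?integral_ge0// ge0_fin_numE ?integral_ge0.
Qed.

Lemma measurable_corr_pdf : measurable_fun setT corr_pdf.
Proof.
apply: measurable_funM => //; apply: measurableT_comp => //.
apply: measurableT_comp => //; apply: measurable_funM => //.
by apply: measurable_funD; [apply: measurable_funB|]; repeat apply: measurable_funM => //.
Qed.

Lemma integrable_poly_growth2 f : measurable_fun setT f -> poly_growth2 f ->
  (mu \x mu)%E.-integrable setT (fun z => (f z * corr_pdf z)%:E).
Proof.
move=> mf /poly_growth2_gauss[C C0 fC].
apply: (le_integrable measurableT _ _ (integrableZl measurableT C integrable_gauss8X)).
  apply/measurable_EFinP/measurable_funM => //; exact: measurable_corr_pdf.
move=> z _ /=; rewrite lee_fin (le_trans (fC z))// ler_norm//.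
Qed.

End gauss2.

(** * Integration by parts against the bivariate density *)

Section ibp2.
Context {R : realType}.
Local Notation mu := (@lebesgue_measure R).
Variable r : R.
Hypothesis r1 : `|r| < 1.

Let r2 : 0 < 1 - r ^+ 2.
Proof. by rewrite subr_gt0 -real_normK ?num_real// expr_lt1. Qed.

Lemma corr_pdfC (x y : R) : corr_pdf r (x, y) = corr_pdf r (y, x).
Proof. by rewrite /corr_pdf /=; congr (expR _ / _); field; rewrite gt_eqF. Qed.

Lemma is_derive_corr_pdf (x y : R) :
  is_derive x 1 (fun t => corr_pdf r (t, y)) (- ((x - r * y) / (1 - r ^+ 2) * corr_pdf r (x, y))).
Proof.
rewrite /corr_pdf /=; set K := (2 * pi * _)^-1.
pose q (t : R) := - ((t ^+ 2 - 2 * r * t * y + y ^+ 2) / (2 * (1 - r ^+ 2))).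
have dq : is_derive x 1 q (- ((x - r * y) / (1 - r ^+ 2))).
  rewrite /q; apply: is_derive_eq.
  rewrite !scaler0 /GRing.scale/=.
  by field; rewrite gt_eqF.
have de := @is_derive1_comp _ expR q x _ _ (is_derive_expR _) dq.
rewrite -/(q x).
have -> : (fun t : R => expR (- ((t ^+ 2 - 2 * r * t * y + y ^+ 2) / (2 * (1 - r ^+ 2)))) * K)
   = (K *: (expR \o q)).
  by apply/funext => t; rewrite /= mulrC.
apply: is_derive_eq. rewrite /GRing.scale/=. ring.
Qed.

Lemma poly_growth2D (f g : R * R -> R) :
  poly_growth2 f -> poly_growth2 g -> poly_growth2 (f \+ g).
Proof.
move=> [C [m fC]] [D [k gD]]; exists (`|C| + `|D|), (m + k)%N => z /=.
have w1 : 1 <= 1 + z.1 ^+ 2 + z.2 ^+ 2 by rewrite -addrA lerDl addr_ge0 ?sqr_ge0.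
have w0 := le_trans ler01 w1.
rewrite (le_trans (ler_normD _ _))// mulrDl lerD//.
  apply: (le_trans (fC z)); apply: (@le_trans _ _ (`|C| * (1 + z.1 ^+ 2 + z.2 ^+ 2) ^+ m)).
    by rewrite ler_wpM2r ?ler_norm// exprn_ge0.
  by rewrite ler_wpM2l// ler_weXn2l// leq_addr.
apply: (le_trans (gD z)); apply: (@le_trans _ _ (`|D| * (1 + z.1 ^+ 2 + z.2 ^+ 2) ^+ k)).
  by rewrite ler_wpM2r ?ler_norm// exprn_ge0.
by rewrite ler_wpM2l// ler_weXn2l// leq_addl.
Qed.

Lemma poly_growth2M (f g : R * R -> R) :
  poly_growth2 f -> poly_growth2 g -> poly_growth2 (f \* g).
Proof.
move=> [C [m fC]] [D [k gD]]; exists (C * D), (m + k)%N => z /=.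
rewrite normrM exprD mulrACA; exact: ler_pM.
Qed.

Lemma poly_growth2Z (a : R) (f : R * R -> R) :
  poly_growth2 f -> poly_growth2 (fun z => a * f z).
Proof.
move=> [C [m fC]]; exists (`|a| * C), m => z.
by rewrite normrM -mulrA ler_wpM2l.
Qed.

Lemma poly_growth2_fst : poly_growth2 (fst : R * R -> R).
Proof.
exists 1, 1%N => z; rewrite mul1r expr1.
have h : 0 <= `|z.1| by [].
have := sqr_ge0 (`|z.1| - 1); rewrite sqrrB1 real_normK ?num_real//.
have := sqr_ge0 z.2; lra.
Qed.

Lemma poly_growth2_snd : poly_growth2 (snd : R * R -> R).
Proof.
exists 1, 1%N => z; rewrite mul1r expr1.
have h : 0 <= `|z.2| by [].
have := sqr_ge0 (`|z.2| - 1); rewrite sqrrB1 real_normK ?num_real//.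
have := sqr_ge0 z.1; lra.
Qed.

Variables (phi phi1 phi2 : R * R -> R).
Hypotheses (mphi : measurable_fun setT phi) (mphi1 : measurable_fun setT phi1)
  (mphi2 : measurable_fun setT phi2).
Hypotheses (gphi : poly_growth2 phi) (gphi1 : poly_growth2 phi1)
  (gphi2 : poly_growth2 phi2).
Hypotheses (dphi1 : forall x y : R, is_derive x 1 (fun t => phi (t, y)) (phi1 (x, y)))
  (dphi2 : forall x y : R, is_derive y 1 (fun t => phi (x, t)) (phi2 (x, y))).
Hypotheses (cphi1 : forall y : R, continuous (fun t => phi1 (t, y)))
  (cphi2 : forall x : R, continuous (fun t => phi2 (x, t))).

(** [A] times the density is minus the derivative of [phi] times the density in the first
    coordinate, and [B] plays the same role in the second. For a frozen other coordinate the
    integral of such a derivative is 0. *)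
Let A (z : R * R) := (z.1 - r * z.2) / (1 - r ^+ 2) * phi z - phi1 z.
Let B (z : R * R) := (z.2 - r * z.1) / (1 - r ^+ 2) * phi z - phi2 z.

Let mA : measurable_fun setT A.
Proof.
apply: measurable_funB => //; apply: measurable_funM => //.
by apply: measurable_funM => //; apply: measurable_funB => //; exact: measurable_funM.
Qed.

Let mB : measurable_fun setT B.
Proof.
apply: measurable_funB => //; apply: measurable_funM => //.
by apply: measurable_funM => //; apply: measurable_funB => //; exact: measurable_funM.
Qed.

Let gA : poly_growth2 A.
Proof.
have -> : A = ((fun z => (1 - r ^+ 2)^-1 * (fst \+ (fun z => (- r) * z.2)) z) \* phi)
   \+ (fun z => -1 * phi1 z).
  by apply/funext => z; rewrite /A /=; ring.
apply: poly_growth2D; last exact: poly_growth2Z.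
apply: poly_growth2M => //; apply: poly_growth2Z; apply: poly_growth2D.
  exact: poly_growth2_fst.
by apply: poly_growth2Z; exact: poly_growth2_snd.
Qed.

Let gB : poly_growth2 B.
Proof.
have -> : B = ((fun z => (1 - r ^+ 2)^-1 * (snd \+ (fun z => (- r) * z.1)) z) \* phi)
   \+ (fun z => -1 * phi2 z).
  by apply/funext => z; rewrite /B /=; ring.
apply: poly_growth2D; last exact: poly_growth2Z.
apply: poly_growth2M => //; apply: poly_growth2Z; apply: poly_growth2D.
  exact: poly_growth2_snd.
by apply: poly_growth2Z; exact: poly_growth2_fst.
Qed.

Let derive_cont (f g : R -> R) : (forall x : R, is_derive x 1 f (g x)) -> continuous f.
Proof.
by move=> fg x; apply/differentiable_continuous/derivable1_diffP; have [] := fg x.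
Qed.

Let affine_cont (a b : R) : continuous (fun x : R => (x - a) / b).
Proof.
apply: (@derive_cont _ (fun=> b^-1)) => x; apply: is_derive_eq.
by rewrite /GRing.scale/=; ring.
Qed.

Let intA0 : (\int[(mu \x mu)%E]_z (A z * corr_pdf r z)%:E = 0)%E.
Proof.
have iA := integrable_poly_growth2 r1 mA gA.
rewrite -integral21_prod_meas1// (_ : fubini_G _ _ = cst 0%E) ?integral0//.
apply/funext => y; rewrite /fubini_G.
have [C C0 hC] := poly_growth2_gauss r1 gphi.
have [D D0 hD] := poly_growth2_gauss r1 gA.
have cp : continuous (fun x => corr_pdf r (x, y)).
  exact: (derive_cont (is_derive_corr_pdf^~ y)).
have cf : continuous (fun x => phi (x, y)) := derive_cont (dphi1^~ y).
apply: (@integral_derive_eq0 _ (fun x => - (phi (x, y) * corr_pdf r (x, y)))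
   (fun x => A (x, y) * corr_pdf r (x, y)) ((C + D) * gauss8 y)).
- move=> x; have h := is_deriveN (is_deriveM (dphi1 x y) (is_derive_corr_pdf x y)).
  apply: (@is_derive_eq _ _ _ _ _ _ _ _ h).
  by rewrite /GRing.scale/= /A/=; ring.
- move=> x; apply: cvgM; last exact: cp.
  apply: cvgB; last exact: cphi1.
  apply: cvgM; last exact: cf.
  exact: affine_cont.
- move=> x; rewrite normrN (le_trans (hC _))//= -mulrA (mulrC (gauss8 x)).
  by rewrite ler_wpM2r ?lerDl// mulr_ge0// ltW// gauss8_gt0.
- move=> x; rewrite (le_trans (hD _))//= -mulrA (mulrC (gauss8 x)).
  by rewrite ler_wpM2r ?lerDr// mulr_ge0// ltW// gauss8_gt0.
Qed.

Let intB0 : (\int[(mu \x mu)%E]_z (B z * corr_pdf r z)%:E = 0)%E.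
Proof.
have iB := integrable_poly_growth2 r1 mB gB.
rewrite -integral12_prod_meas1// (_ : fubini_F _ _ = cst 0%E) ?integral0//.
apply/funext => x; rewrite /fubini_F.
have [C C0 hC] := poly_growth2_gauss r1 gphi.
have [D D0 hD] := poly_growth2_gauss r1 gB.
have dp y : is_derive (y : R) 1 (fun t => corr_pdf r (x, t))
    (- ((y - r * x) / (1 - r ^+ 2) * corr_pdf r (x, y))).
  rewrite corr_pdfC (_ : (fun t => _) = (fun t => corr_pdf r (t, x))).
    exact: is_derive_corr_pdf.
  by apply/funext => t; rewrite corr_pdfC.
have cp : continuous (fun y => corr_pdf r (x, y)) := derive_cont dp.
have cf : continuous (fun y => phi (x, y)) := derive_cont (dphi2 x).
apply: (@integral_derive_eq0 _ (fun y => - (phi (x, y) * corr_pdf r (x, y)))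
   (fun y => B (x, y) * corr_pdf r (x, y)) ((C + D) * gauss8 x)).
- move=> y; have h := is_deriveN (is_deriveM (dphi2 x y) (dp y)).
  apply: (@is_derive_eq _ _ _ _ _ _ _ _ h).
  by rewrite /GRing.scale/= /B/=; ring.
- move=> y; apply: cvgM; last exact: cp.
  apply: cvgB; last exact: cphi2.
  apply: cvgM; last exact: cf.
  exact: affine_cont.
- move=> y; rewrite normrN (le_trans (hC _))//= -mulrA.
  by rewrite ler_wpM2r ?lerDl// mulr_ge0// ltW// gauss8_gt0.
- move=> y; rewrite (le_trans (hD _))//= -mulrA.
  by rewrite ler_wpM2r ?lerDr// mulr_ge0// ltW// gauss8_gt0.
Qed.

(** The combination [A + r * B] undoes the inverse covariance: (z.1 - r z.2) + r (z.2 - r z.1) = (1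
    - r^2) z.1. *)
Lemma corr_pdf_ibp1 :
  (\int[(mu \x mu)%E]_z ((z.1 * phi z - phi1 z - r * phi2 z) * corr_pdf r z)%:E = 0)%E.
Proof.
have iA := integrable_poly_growth2 r1 mA gA.
have iB := integrable_poly_growth2 r1 mB gB.
transitivity (\int[(mu \x mu)%E]_z ((A z * corr_pdf r z)%:E + r%:E * (B z * corr_pdf r z)%:E))%E.
  apply: eq_integral => z _; rewrite -EFinM -EFinD; congr EFin.
  by rewrite /A /B; field; rewrite gt_eqF.
rewrite integralD//=; last exact: integrableZl.
by rewrite integralZl// intA0 intB0 mule0 adde0.
Qed.

Lemma corr_pdf_ibp2 :
  (\int[(mu \x mu)%E]_z ((z.2 * phi z - r * phi1 z - phi2 z) * corr_pdf r z)%:E = 0)%E.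
Proof.
have iA := integrable_poly_growth2 r1 mA gA.
have iB := integrable_poly_growth2 r1 mB gB.
transitivity (\int[(mu \x mu)%E]_z ((B z * corr_pdf r z)%:E + r%:E * (A z * corr_pdf r z)%:E))%E.
  apply: eq_integral => z _; rewrite -EFinM -EFinD; congr EFin.
  by rewrite /A /B; field; rewrite gt_eqF.
rewrite integralD//=; last exact: integrableZl.
by rewrite integralZl// intA0 intB0 mule0 adde0.
Qed.

End ibp2.

(** * From the density to the law of a Gaussian pair *)

Section gauss2_integral.
Context {R : realType}.
Local Notation mu := (@lebesgue_measure R).
Variables (r : R) (nu : probability (R * R)%type R).
Hypothesis r1 : `|r| < 1.
Hypothesis gaussian : centered_gaussian2 (corr_mx r) nu.

Local Notation R2 := (g_sigma_algebraType (R.-ocitv.-measurable) *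
  g_sigma_algebraType (R.-ocitv.-measurable))%type.

(* The library's Lebesgue measure lives on a copy of [R] with another display. *)
Let toR2 (z : R * R) : R2 := z.

Let mtoR2 : measurable_fun setT toR2.
Proof. move=> mD Y mY; rewrite setTI; exact: mY. Qed.

HB.instance Definition _ := isMeasurableFun.Build _ _ _ _ toR2 mtoR2.

Local Notation nu' := (pushforward nu toR2).

Let nu'E A : measurable A -> nu' A =
  (\int[(mu \x mu)%E]_(z in A) (corr_pdf r z)%:E)%E.
Proof. by move=> mA; rewrite /pushforward gaussian// gauss2_pdfE. Qed.

Lemma integrable_gauss2 (f : R * R -> R) : measurable_fun setT f -> poly_growth2 f ->
  nu.-integrable setT (EFin \o f).
Proof.
move=> mf gf.
have h := @integrable_density _ R2 _ (mu \x mu)%E nu' (corr_pdf r)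
  (measurable_corr_pdf r) (corr_pdf_ge0 r) nu'E f mf
  (integrable_poly_growth2 r1 mf gf).
move/integrableP : (h mtoR2) => [_ {}h]; apply/integrableP; split; first exact/measurable_EFinP.
move: h; rewrite ge0_integral_pushforward//.
by apply: measurableT_comp => //; exact/measurable_EFinP.
Qed.

Lemma integral_gauss2 (f : R * R -> R) : measurable_fun setT f -> poly_growth2 f ->
  (\int[nu]_z (f z)%:E = \int[(mu \x mu)%E]_z (f z * corr_pdf r z)%:E)%E.
Proof.
move=> mf gf.
rewrite -(@integral_density _ R2 _ (mu \x mu)%E nu' (corr_pdf r)
  (measurable_corr_pdf r) (corr_pdf_ge0 r) nu'E f mf
  (integrable_poly_growth2 r1 mf gf)).
rewrite integral_pushforward//; first exact/measurable_EFinP.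
exact: integrable_gauss2.
Qed.
End gauss2_integral.

(** * Smooth functionals of polynomial growth *)

Section tame.
Context {R : realType} {I : finType}.
Implicit Types (phi psi : (I -> R) -> R) (c : I -> R).

Lemma updateK c (j : I) (s t : R) : update (update c j s) j t = update c j t.
Proof. by apply/funext => k; rewrite /update; case: eqP. Qed.

Lemma update_same c (j : I) (s : R) : update c j s j = s.
Proof. by rewrite /update eqxx. Qed.

Lemma update_id c (j : I) : update c j (c j) = c.
Proof. by apply/funext => k; rewrite /update; case: eqP => // ->. Qed.

(** The summand 1 makes powers increase with the exponent, so that growth bounds of different
    degrees can be added. *)
Definition sqsum c : R := 1 + \sum_j c j ^+ 2.

Lemma sqsum_ge1 c : 1 <= sqsum c.
Proof. by rewrite lerDl sumr_ge0// => j _; rewrite sqr_ge0. Qed.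

Lemma sqsum_ge0 c : 0 <= sqsum c.
Proof. exact: le_trans ler01 (sqsum_ge1 c). Qed.

Definition tame phi :=
  measurable_functional phi /\ exists C m, forall c, `|phi c| <= C * sqsum c ^+ m.

Lemma tame_cst a : tame (fun=> a).
Proof.
split; first by move=> d T z mz; exact: measurable_cst.
by exists `|a|, 0%N => c; rewrite expr0 mulr1.
Qed.

Lemma tame_coord j : tame (fun c => c j).
Proof.
split; first by move=> d T z mz.
exists 1, 1%N => c; rewrite mul1r expr1 /sqsum (bigD1 j)//=.
have h : 0 <= `|c j| by [].
have := sqr_ge0 (`|c j| - 1); rewrite sqrrB1 real_normK ?num_real//.
have : 0 <= \sum_(i | i != j) c i ^+ 2 by rewrite sumr_ge0// => i _; rewrite sqr_ge0.
lra.
Qed.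

Lemma tameD phi psi : tame phi -> tame psi -> tame (fun c => phi c + psi c).
Proof.
move=> [mf [C [m fC]]] [mg [D [k gD]]]; split.
  by move=> d T z mz; apply: measurable_funD; [exact: mf|exact: mg].
exists (`|C| + `|D|), (m + k)%N => c.
rewrite (le_trans (ler_normD _ _))// mulrDl lerD//.
  apply: (le_trans (fC c)); apply: (@le_trans _ _ (`|C| * sqsum c ^+ m)).
    by rewrite ler_wpM2r ?ler_norm// exprn_ge0// sqsum_ge0.
  by rewrite ler_wpM2l// ler_weXn2l ?sqsum_ge1// leq_addr.
apply: (le_trans (gD c)); apply: (@le_trans _ _ (`|D| * sqsum c ^+ k)).
  by rewrite ler_wpM2r ?ler_norm// exprn_ge0// sqsum_ge0.
by rewrite ler_wpM2l// ler_weXn2l ?sqsum_ge1// leq_addl.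
Qed.

Lemma tameM phi psi : tame phi -> tame psi -> tame (fun c => phi c * psi c).
Proof.
move=> [mf [C [m fC]]] [mg [D [k gD]]]; split.
  by move=> d T z mz; apply: measurable_funM; [exact: mf|exact: mg].
exists (C * D), (m + k)%N => c.
by rewrite normrM exprD mulrACA; exact: ler_pM.
Qed.

Lemma tameZ a phi : tame phi -> tame (fun c => a * phi c).
Proof. by move=> h; apply: tameM => //; exact: tame_cst. Qed.

Lemma tameN phi : tame phi -> tame (fun c => - phi c).
Proof. by move=> /(tameZ (-1)); congr tame; apply/funext => c; rewrite mulN1r. Qed.

Lemma tameB phi psi : tame phi -> tame psi -> tame (fun c => phi c - psi c).
Proof. by move=> h k; apply: tameD => //; exact: tameN. Qed.

Lemma tameX phi k : tame phi -> tame (fun c => phi c ^+ k).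
Proof.
move=> h; elim: k => [|k IH]; first exact: (tame_cst 1).
have := tameM h IH; congr tame; apply/funext => c; by rewrite exprS.
Qed.

Lemma tame_sum (K : Type) (s : seq K) (p : pred K) (phi : K -> (I -> R) -> R) :
  (forall k, tame (phi k)) -> tame (fun c => \sum_(k <- s | p k) phi k c).
Proof.
move=> h; elim: s => [|k s IH].
  by have := tame_cst 0; congr tame; apply/funext => c; rewrite big_nil.
case pk: (p k).
  by have := tameD (h k) IH; congr tame; apply/funext => c; rewrite big_cons pk.
by move: IH; congr tame; apply/funext => c; rewrite big_cons pk.
Qed.

Lemma tame_comp (f : R -> R) (K : R) phi : measurable_fun setT f ->
  (forall x, `|f x| <= K * (1 + `|x|)) -> tame phi -> tame (fun c => f (phi c)).
Proof.
move=> mf fK [mphi [C [m phiC]]]; split.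
  by move=> d T z mz; apply: (measurableT_comp mf); exact: mphi.
exists (`|K| * (1 + `|C|)), m => c.
apply: (le_trans (fK _)); apply: (@le_trans _ _ (`|K| * (1 + `|phi c|))).
  by rewrite ler_wpM2r ?ler_norm// addr_ge0.
rewrite -mulrA ler_wpM2l// mulrDl mul1r lerD//.
  by rewrite exprn_ege1// sqsum_ge1.
apply: (le_trans (phiC c)).
by rewrite ler_wpM2r ?ler_norm// exprn_ge0// sqsum_ge0.
Qed.

Lemma tame_norm phi : tame phi -> tame (fun c => `|phi c|).
Proof.
apply: (@tame_comp _ 1); first by exact: measurable_realfun.normr_measurable.
by move=> x; rewrite mul1r normr_id lerDr.
Qed.

(** The gradient is part of the data, so that the gradients of composed functionals stay explicit.
    Continuity is asked along coordinate lines, which is what the one-dimensional fundamental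
    theorem of calculus uses. *)
Definition smooth phi (dphi : I -> (I -> R) -> R) :=
  [/\ tame phi, forall j, tame (dphi j),
      forall c j, is_derive (c j) 1 (fun t : R => phi (update c j t)) (dphi j c) &
      forall c j, continuous (fun t : R => dphi j (update c j t))].

Lemma smooth_is_derive phi dphi c j (t : R) : smooth phi dphi ->
  is_derive t 1 (fun s : R => phi (update c j s)) (dphi j (update c j t)).
Proof.
case=> _ _ /(_ (update c j t) j) + _; rewrite update_same.
by under eq_fun do rewrite updateK.
Qed.

Lemma smooth_continuous phi dphi c j : smooth phi dphi ->
  continuous (fun s : R => phi (update c j s)).
Proof.
move=> h t; apply/differentiable_continuous/derivable1_diffP.
by have [] := smooth_is_derive c j t h.
Qed.

Lemma smooth_cst a : smooth (fun=> a) (fun _ _ => 0).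
Proof.
split; [exact: tame_cst|move=> j; exact: tame_cst|move=> c j; exact: is_derive_cst|].
by move=> c j t; exact: cvg_cst.
Qed.

Lemma smooth_coord j : smooth (fun c => c j) (fun k _ => (k == j)%:R).
Proof.
split; [exact: tame_coord|move=> k; exact: tame_cst| |by move=> c k t; exact: cvg_cst].
move=> c k; rewrite /update; have [_|kj] := eqVneq k j; first exact: is_derive_id.
exact: is_derive_cst.
Qed.

Lemma smoothD phi dphi psi dpsi : smooth phi dphi -> smooth psi dpsi ->
  smooth (fun c => phi c + psi c) (fun j c => dphi j c + dpsi j c).
Proof.
move=> [t1 u1 d1 c1] [t2 u2 d2 c2]; split; first exact: tameD.
- by move=> j; exact: tameD.
- by move=> c j; exact: is_deriveD.
- by move=> c j t; apply: cvgD; [exact: c1|exact: c2].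
Qed.

Lemma smoothM phi dphi psi dpsi : smooth phi dphi -> smooth psi dpsi ->
  smooth (fun c => phi c * psi c) (fun j c => dphi j c * psi c + phi c * dpsi j c).
Proof.
move=> h1 h2; have [t1 u1 d1 c1] := h1; have [t2 u2 d2 c2] := h2.
split; first exact: tameM.
- by move=> j; apply: tameD; exact: tameM.
- move=> c j; apply: (is_derive_eq (is_deriveM (d1 c j) (d2 c j))).
  by rewrite /GRing.scale/= update_id addrC mulrC.
- move=> c j t; apply: cvgD; apply: cvgM; try exact: c1; try exact: c2.
    exact: (smooth_continuous h2).
  exact: (smooth_continuous h1).
Qed.

Lemma smoothZ a phi dphi : smooth phi dphi ->
  smooth (fun c => a * phi c) (fun j c => a * dphi j c).
Proof.
move=> h; have := smoothM (smooth_cst a) h; congr smooth.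
by apply/funext => j; apply/funext => c; rewrite mul0r add0r.
Qed.

Lemma smooth_sum (K : Type) (s : seq K) (p : pred K) (phi : K -> (I -> R) -> R)
    (dphi : K -> I -> (I -> R) -> R) : (forall k, smooth (phi k) (dphi k)) ->
  smooth (fun c => \sum_(k <- s | p k) phi k c)
         (fun j c => \sum_(k <- s | p k) dphi k j c).
Proof.
move=> h; elim: s => [|k s IH].
  have := smooth_cst 0; congr smooth; first by apply/funext => c; rewrite big_nil.
  by apply/funext => j; apply/funext => c; rewrite big_nil.
case pk: (p k).
  have := smoothD (h k) IH; congr smooth; first by apply/funext => c; rewrite big_cons pk.
  by apply/funext => j; apply/funext => c; rewrite big_cons pk.
move: IH; congr smooth; first by apply/funext => c; rewrite big_cons pk.
by apply/funext => j; apply/funext => c; rewrite big_cons pk.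
Qed.

Lemma smooth_comp (f df : R -> R) (K : R) phi dphi :
  (forall x : R, is_derive x 1 f (df x)) -> continuous df ->
  (forall x, `|f x| <= K * (1 + `|x|)) -> (forall x, `|df x| <= K * (1 + `|x|)) ->
  smooth phi dphi -> smooth (fun c => f (phi c)) (fun j c => df (phi c) * dphi j c).
Proof.
move=> fdf cdf fK dfK h; have [t1 u1 d1 c1] := h.
have cf : continuous f.
  by move=> x; apply/differentiable_continuous/derivable1_diffP; have [] := fdf x.
split.
- by apply: (tame_comp _ fK) => //; exact: continuous_measurable_fun.
- move=> j; apply: tameM => //; apply: (tame_comp _ dfK) => //.
  exact: continuous_measurable_fun.
- move=> c j.
  have h1 : is_derive ((fun t : R => phi (update c j t)) (c j)) 1 f (df (phi c)).
    by rewrite update_id; exact: fdf.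
  exact: (is_derive1_comp h1 (d1 c j)).
- move=> c j t; apply: cvgM; last exact: c1.
  by apply: continuous_comp; [exact: (smooth_continuous h)|exact: cdf].
Qed.

End tame.

(** * Integration by parts for an independent Gaussian sample *)

Section gaussian_system.
Context d (T : measurableType d) {R : realType} (P : probability T R).
Variables (r : R) (n : nat) (Z : 'I_n -> {mfun T >-> (R * R)%type}).
Hypothesis r1 : `|r| < 1.
Hypothesis indep : forall A : 'I_n -> set (R * R), (forall i, measurable (A i)) ->
  P (\big[setI/[set: T]]_i (Z i @^-1` A i)) = (\prod_i P (Z i @^-1` A i))%E.
Hypothesis gaussian : forall i, centered_gaussian2 (corr_mx r) (distribution P (Z i)).

Local Notation J := (bool * 'I_n)%type.

Definition coords (z : 'I_n -> R * R) (j : J) : R :=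
  if j.1 then (z j.2).2 else (z j.2).1.

Definition sample (w : T) : J -> R := coords (fun i => Z i w).

Definition corr (a b : bool) : R := if a == b then 1 else r.

Let measurable_coords d' (T' : measurableType d') (z : 'I_n -> T' -> R * R) :
  (forall i, measurable_fun setT (z i)) ->
  forall j, measurable_fun setT (fun w => coords (z ^~ w) j).
Proof.
move=> mz [[] i]; rewrite /coords /=.
  exact: (measurableT_comp measurable_snd (mz i)).
exact: (measurableT_comp measurable_fst (mz i)).
Qed.

Lemma measurable_sample (phi : (J -> R) -> R) :
  measurable_functional phi -> measurable_fun setT (phi \o sample).
Proof.
by move=> mphi; apply: (mphi _ _ (fun j w => sample w j)); exact: measurable_coords.
Qed.

Let measurable_sample1 j : measurable_fun setT (fun w => sample w j).
Proof. exact: measurable_coords. Qed.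

Lemma integrable_coord (j : J) (m : nat) :
  P.-integrable setT (fun w => ((sample w j ^+ 2) ^+ m)%:E).
Proof.
pose f (z : R * R) : R := ((if j.1 then z.2 else z.1) ^+ 2) ^+ m.
have mf : measurable_fun setT f.
  rewrite /f; do 2 apply: measurable_funX; by case: j.1; [exact: measurable_snd|exact: measurable_fst].
have gf : poly_growth2 f.
  exists 1, m => z; rewrite mul1r normrX lerXn2r ?nnegrE ?addr_ge0 ?sqr_ge0//.
  rewrite ger0_norm ?sqr_ge0//; have := sqr_ge0 z.1; have := sqr_ge0 z.2.
  by case: j.1; lra.
have := integrable_gauss2 r1 (@gaussian j.2) mf gf.
move=> /integrableP[_ h]; apply/integrableP; split.
  apply/measurable_EFinP; do 2 apply: measurable_funX.
  exact: measurable_sample1.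
move: h; rewrite ge0_integral_distribution//; last first.
  by apply/measurableT_comp => //; apply/measurable_EFinP.
Qed.

Let expr_addl (x y : R) m : 0 <= x -> 0 <= y ->
  (x + y) ^+ m <= 2 ^+ m * (x ^+ m + y ^+ m).
Proof.
move=> x0 y0; wlog xy : x y x0 y0 / x <= y.
  move=> h; have [xy|yx] := leP x y; first exact: h.
  by rewrite addrC [_ ^+ m + _]addrC; apply: h => //; exact: ltW.
apply: (@le_trans _ _ ((2 * y) ^+ m)).
  by rewrite lerXn2r ?nnegrE ?addr_ge0 ?mulr_ge0//; lra.
by rewrite exprMn ler_wpM2l ?exprn_ge0// lerDr exprn_ge0.
Qed.

(** Peeling off one square at a time with (x + y)^m <= 2^m (x^m + y^m) reduces the claim to moments
    of single coordinates. *)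
Lemma integrable_sqsum m : P.-integrable setT (fun w => (sqsum (sample w) ^+ m)%:E).
Proof.
rewrite /sqsum; elim: (index_enum _) => [|j s IH].
  under eq_fun do rewrite big_nil addr0 expr1n.
  exact: finite_measure_integrable_cst.
have h : P.-integrable setT (fun w => ((2 ^+ m)%:E *
   (((1 + \sum_(j <- s) sample w j ^+ 2) ^+ m)%:E + ((sample w j ^+ 2) ^+ m)%:E))%E).
  apply: integrableZl => //; apply: integrableD => //; exact: integrable_coord.
apply: (le_integrable measurableT _ _ h).
  apply/measurable_EFinP/measurable_funX/measurable_funD => //.
  apply: (@measurable_sum _ _ _ setT _ (j :: s) (fun j w => sample w j ^+ 2)) => k.
  apply: measurable_funX; exact: measurable_sample1.
move=> w _.
have s0 : 0 <= \sum_(j <- s) sample w j ^+ 2.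
  by rewrite sumr_ge0// => i _; exact: sqr_ge0.
rewrite big_cons -EFinD -EFinM lee_fin.
rewrite !ger0_norm; last 2 first.
- by apply: mulr_ge0; [exact: exprn_ge0|apply: addr_ge0; apply: exprn_ge0; rewrite ?addr_ge0 ?sqr_ge0].
- by rewrite exprn_ge0// addr_ge0// addr_ge0// sqr_ge0.
rewrite addrCA addrC; apply: expr_addl; first exact: addr_ge0.
exact: sqr_ge0.
Qed.

Lemma integrable_tame phi : tame phi -> P.-integrable setT (EFin \o (phi \o sample)).
Proof.
move=> [mphi [C [m hC]]].
apply: (le_integrable measurableT _ _ (integrableZl measurableT `|C| (integrable_sqsum m))).
  exact/measurable_EFinP/measurable_sample.
move=> w _ /=; rewrite lee_fin (le_trans (hC _))//.
rewrite [leRHS]ger0_norm; last by rewrite mulr_ge0// exprn_ge0 ?sqsum_ge0.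
by rewrite ler_wpM2r ?ler_norm// exprn_ge0 ?sqsum_ge0.
Qed.

Definition Ex (phi : (J -> R) -> R) : R := \int[P]_w phi (sample w).

Lemma eq_Ex phi psi : phi =1 psi -> Ex phi = Ex psi.
Proof. by move=> h; apply: eq_Rintegral => w _; rewrite h. Qed.

Lemma Ex_cst a : Ex (fun=> a) = a.
Proof. by rewrite /Ex Rintegral_cst//= probability_setT mulr1. Qed.

Lemma ExD phi psi : tame phi -> tame psi -> Ex (fun c => phi c + psi c) = Ex phi + Ex psi.
Proof. by move=> h k; apply: RintegralD => //; exact: integrable_tame. Qed.

Lemma ExZ a phi : tame phi -> Ex (fun c => a * phi c) = a * Ex phi.
Proof. by move=> h; apply: RintegralZl => //; exact: integrable_tame. Qed.

Lemma ExN phi : tame phi -> Ex (fun c => - phi c) = - Ex phi.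
Proof.
by move=> h; rewrite -mulN1r -ExZ//; apply: eq_Ex => c; rewrite mulN1r.
Qed.

Lemma ExB phi psi : tame phi -> tame psi -> Ex (fun c => phi c - psi c) = Ex phi - Ex psi.
Proof. by move=> h k; rewrite ExD ?ExN//; exact: tameN. Qed.

Lemma Ex_sum (K : Type) (s : seq K) (p : pred K) (phi : K -> (J -> R) -> R) :
  (forall k, tame (phi k)) ->
  Ex (fun c => \sum_(k <- s | p k) phi k c) = \sum_(k <- s | p k) Ex (phi k).
Proof.
move=> h; elim: s => [|k s IH].
  rewrite big_nil -[RHS](Ex_cst 0); apply: eq_Ex => c; by rewrite big_nil.
rewrite big_cons; case pk: (p k).
  rewrite -IH -ExD//; last exact: tame_sum.
  by apply: eq_Ex => c; rewrite big_cons pk.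
by rewrite -IH; apply: eq_Ex => c; rewrite big_cons pk.
Qed.

Lemma le_Ex phi psi : tame phi -> tame psi -> (forall c, phi c <= psi c) -> Ex phi <= Ex psi.
Proof. by move=> h k le; apply: le_Rintegral => //; exact: integrable_tame. Qed.

Lemma le_norm_Ex phi : tame phi -> `|Ex phi| <= Ex (fun c => `|phi c|).
Proof. by move=> h; apply: le_normr_Rintegral => //; exact: integrable_tame. Qed.

(** With all pairs but the [i]-th frozen this is the two-dimensional formula; [integral_indep_eq0]
    then passes to the whole sample. *)
Lemma Ex_ibp (a : bool) (i : 'I_n) phi dphi : smooth phi dphi ->
  Ex (fun c => c (a, i) * phi c) =
  corr a false * Ex (dphi (false, i)) + corr a true * Ex (dphi (true, i)).
Proof.
move=> sphi; have [tphi tdphi _ cdphi] := sphi.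
pose Psi (c : J -> R) := c (a, i) * phi c -
  (corr a false * dphi (false, i) c + corr a true * dphi (true, i) c).
have tPsi : tame Psi.
  apply: tameB; first by apply: tameM => //; exact: tame_coord.
  by apply: tameD; exact: tameZ.
suff : Ex Psi = 0.
  rewrite /Psi ExB; last 2 first.
  - by apply: tameM => //; exact: tame_coord.
  - by apply: tameD; exact: tameZ.
  move=> /eqP; rewrite subr_eq0 => /eqP ->; rewrite ExD ?ExZ//; exact: tameZ.
rewrite /Ex /Rintegral.
have := @integral_indep_eq0 _ T R P _ _ n Z indep i (fun z => Psi (coords z)).
move=> -> //.
- move=> d' T' z mz; have [mPsi _] := tPsi.
  exact: (mPsi _ _ (fun j w => coords (z ^~ w) j) (measurable_coords mz)).
- exact: (integrable_tame tPsi).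
move=> z0.
pose lift (phi : (J -> R) -> R) (z : R * R) := phi (coords (update z0 i z)).
have mlift f : tame f -> measurable_fun setT (lift f).
  move=> [mf _]; apply: (mf _ _ (fun j z => coords (update z0 i z) j)).
  apply: (@measurable_coords _ _ (fun k z => update z0 i z k)) => k.
  by rewrite /update; case: eqP => _; [exact: measurable_id|exact: measurable_cst].
have glift f : tame f -> poly_growth2 (lift f).
  move=> [_ [C [m fC]]]; pose s0 := sqsum (coords z0).
  have s01 : 1 <= s0 by exact: sqsum_ge1.
  exists (`|C| * s0 ^+ m), m => z; rewrite /lift.
  apply: (le_trans (fC _)).
  have w1 : 0 <= 1 + z.1 ^+ 2 + z.2 ^+ 2 by rewrite !addr_ge0 ?sqr_ge0.
  apply: (@le_trans _ _ (`|C| * sqsum (coords (update z0 i z)) ^+ m)).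
    by rewrite ler_wpM2r ?ler_norm// exprn_ge0 ?sqsum_ge0.
  rewrite -mulrA ler_wpM2l// -exprMn lerXn2r ?nnegrE ?sqsum_ge0//.
    by rewrite mulr_ge0// sqsum_ge0.
  apply: (@le_trans _ _ (s0 + (z.1 ^+ 2 + z.2 ^+ 2))).
    rewrite /s0 /sqsum -addrA lerD2l.
    rewrite (bigD1 (false, i))//= (bigD1 (true, i))//=.
    rewrite [in leRHS](bigD1 (false, i))//= [in leRHS](bigD1 (true, i))//=.
    rewrite {1 2}/coords /= /update eqxx.
    set S1 := \sum_(_ | _) _; set S2 := \sum_(_ | _) _.
    have -> : S1 = S2.
      apply: eq_bigr => -[b k]; rewrite !xpair_eqE /coords /update /=.
      by have [->|//] := eqVneq k i; case: b.
    have := sqr_ge0 (coords z0 (true, i)); have := sqr_ge0 (coords z0 (false, i)).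
    lra.
  have := sqr_ge0 z.1; have := sqr_ge0 z.2; nra.
rewrite (integral_gauss2 r1 (@gaussian i) (mlift _ tPsi) (glift _ tPsi)).
have upd1 (x y t : R) : coords (update z0 i (t, y)) =
    update (coords (update z0 i (x, y))) (false, i) t.
  apply/funext => -[b k]; rewrite /coords /update /= xpair_eqE.
  by case: b => /=; case: eqP.
have upd2 (x y t : R) : coords (update z0 i (x, t)) =
    update (coords (update z0 i (x, y))) (true, i) t.
  apply/funext => -[b k]; rewrite /coords /update /= xpair_eqE.
  by case: b => /=; case: eqP.
have upd0 (x y : R) : coords (update z0 i (x, y)) (false, i) = x.
  by rewrite /coords /update /= eqxx.
have upd0' (x y : R) : coords (update z0 i (x, y)) (true, i) = y.
  by rewrite /coords /update /= eqxx.
have D1 (x y : R) : is_derive x 1 (fun t => lift phi (t, y)) (lift (dphi (false, i)) (x, y)).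
  have := smooth_is_derive (coords (update z0 i (x, y))) (false, i) x sphi.
  rewrite -upd1 /lift; under [X in is_derive _ _ X]eq_fun do rewrite -upd1.
  by [].
have D2 (x y : R) : is_derive y 1 (fun t => lift phi (x, t)) (lift (dphi (true, i)) (x, y)).
  have := smooth_is_derive (coords (update z0 i (x, y))) (true, i) y sphi.
  rewrite -upd2 /lift; under [X in is_derive _ _ X]eq_fun do rewrite -upd2.
  by [].
have C1 y : continuous (fun t : R => lift (dphi (false, i)) (t, y)).
  rewrite /lift; under eq_fun do rewrite (upd1 0); exact: cdphi.
have C2 x : continuous (fun t : R => lift (dphi (true, i)) (x, t)).
  rewrite /lift; under eq_fun do rewrite (upd2 _ 0); exact: cdphi.
case: a @Psi tPsi => Psi tPsi.
  have <- := corr_pdf_ibp2 r1 (mlift _ tphi) (mlift _ (tdphi (false, i)))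
     (mlift _ (tdphi (true, i))) (glift _ tphi) (glift _ (tdphi (false, i)))
     (glift _ (tdphi (true, i))) D1 D2 C1 C2.
  apply: eq_integral => -[x y] _; congr (_ * _)%:E.
  by rewrite /lift /Psi /corr upd0' /=; ring.
have <- := corr_pdf_ibp1 r1 (mlift _ tphi) (mlift _ (tdphi (false, i)))
     (mlift _ (tdphi (true, i))) (glift _ tphi) (glift _ (tdphi (false, i)))
     (glift _ (tdphi (true, i))) D1 D2 C1 C2.
apply: eq_integral => -[x y] _; congr (_ * _)%:E.
by rewrite /lift /Psi /corr upd0 /=; ring.
Qed.

End gaussian_system.

(** * Quadratic forms in a Gaussian sample *)

Section forms.
Context {R : realType} {n : nat}.
Local Notation J := (bool * 'I_n)%type.
Implicit Types (M : 'I_n -> 'I_n -> R) (a b : bool) (c : J -> R).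

Definition mxtr M : R := \sum_i M i i.
Definition mxsq M (i j : 'I_n) : R := \sum_k M i k * M k j.
Definition lin M a (i : 'I_n) c : R := \sum_j M i j * c (a, j).
Definition bil M a b c : R := \sum_i c (a, i) * lin M b i c.

Lemma bilC M a b c : (forall i j, M i j = M j i) -> bil M a b c = bil M b a c.
Proof.
move=> sM; rewrite /bil /lin; under eq_bigr do rewrite mulr_sumr.
rewrite exchange_big/=; apply: eq_bigr => i _.
by rewrite mulr_sumr; apply: eq_bigr => j _; rewrite sM; ring.
Qed.

Lemma sum_lin_lin M a b c : (forall i j, M i j = M j i) ->
  \sum_i lin M a i c * lin M b i c = bil (mxsq M) a b c.
Proof.
move=> sM; rewrite /bil /lin /mxsq.
transitivity (\sum_i \sum_j \sum_k M i j * c (a, j) * (M i k * c (b, k))).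
  by apply: eq_bigr => i _; rewrite mulr_suml; apply: eq_bigr => j _; rewrite mulr_sumr.
rewrite exchange_big/=; apply: eq_bigr => j _.
rewrite exchange_big/= mulr_sumr; apply: eq_bigr => k _.
rewrite mulr_suml mulr_sumr; apply: eq_bigr => i _.
by rewrite (sM i j); ring.
Qed.

Lemma mxsqC M : (forall i j, M i j = M j i) -> forall i j, mxsq M i j = mxsq M j i.
Proof. by move=> sM i j; apply: eq_bigr => k _; rewrite mulrC sM (sM k). Qed.

(** The maximal absolute row sum is a submultiplicative norm. *)
Lemma row_sum_mxsq M rho : (forall i, \sum_j `|M i j| <= rho) ->
  forall i, \sum_j `|mxsq M i j| <= rho ^+ 2.
Proof.
move=> hM i; have rho0 : 0 <= rho by apply: le_trans (hM i); exact: sumr_ge0.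
apply: (@le_trans _ _ (\sum_j \sum_k `|M i k| * `|M k j|)).
  apply: ler_sum => j _; rewrite (le_trans (ler_norm_sum _ _ _))//.
  by apply: ler_sum => k _; rewrite normrM.
rewrite exchange_big/=; under eq_bigr do rewrite -mulr_sumr.
apply: (@le_trans _ _ (\sum_k `|M i k| * rho)).
  by apply: ler_sum => k _; rewrite ler_wpM2l.
by rewrite -mulr_suml expr2 ler_wpM2r.
Qed.

Lemma mxtr_mxsq M : (forall i j, M i j = M j i) -> mxtr (mxsq M) = \sum_i \sum_j M i j ^+ 2.
Proof.
by move=> sM; apply: eq_bigr => i _; apply: eq_bigr => j _; rewrite (sM j) expr2.
Qed.

Lemma mxtr_mxsq_ge0 M : (forall i j, M i j = M j i) -> 0 <= mxtr (mxsq M).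
Proof.
by move=> sM; rewrite mxtr_mxsq// sumr_ge0// => i _; rewrite sumr_ge0// => j _; exact: sqr_ge0.
Qed.

(** For symmetric [M] the trace is the sum of the squared entries; one factor of each square is
    bounded by [rho], and the other one is summed along its row. *)
Lemma mxtr_mxsq_le M rho : (forall i j, M i j = M j i) ->
  (forall i, \sum_j `|M i j| <= rho) -> mxtr (mxsq M) <= n%:R * rho ^+ 2.
Proof.
move=> sM hM; rewrite mxtr_mxsq//.
apply: (@le_trans _ _ (\sum_(i < n) rho ^+ 2)); last first.
  by rewrite sumr_const card_ord mulr_natl.
apply: ler_sum => i _; have rho0 : 0 <= rho by apply: le_trans (hM i); exact: sumr_ge0.
apply: (@le_trans _ _ (\sum_j `|M i j| * rho)); last first.
  by rewrite -mulr_suml expr2 ler_wpM2r.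
apply: ler_sum => j _; rewrite -(real_normK (num_real (M i j))) expr2 ler_wpM2l//.
apply: le_trans (hM i); rewrite (bigD1 j)//= lerDl; exact: sumr_ge0.
Qed.

Lemma smooth_lin M a i :
  smooth (lin M a i) (fun k _ => (k.1 == a)%:R * M i k.2).
Proof.
have := @smooth_sum R J _ (index_enum 'I_n) xpredT _ _
  (fun j => smoothZ (M i j) (smooth_coord (a, j))).
congr smooth; apply/funext => -[e k]; apply/funext => c /=.
rewrite (bigD1 k)//= big1 ?addr0 => [|j jk]; rewrite xpair_eqE.
  by rewrite eqxx andbT mulrC.
by rewrite [k == j]eq_sym (negbTE jk) andbF mulr0.
Qed.

Lemma smooth_bil M a b : (forall i j, M i j = M j i) ->
  smooth (bil M a b)
    (fun k c => (k.1 == a)%:R * lin M b k.2 c + (k.1 == b)%:R * lin M a k.2 c).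
Proof.
move=> sM; have := @smooth_sum R J _ (index_enum 'I_n) xpredT _ _
  (fun i => smoothM (smooth_coord (a, i)) (smooth_lin M b i)).
congr smooth; apply/funext => -[e k]; apply/funext => c /=.
rewrite big_split/=; congr (_ + _).
  rewrite (bigD1 k)//= big1 ?addr0 => [|j jk]; rewrite xpair_eqE ?eqxx ?andbT//.
  by rewrite [k == j]eq_sym (negbTE jk) andbF mul0r.
by rewrite /lin mulr_sumr; apply: eq_bigr => i _; rewrite sM; ring.
Qed.

Lemma tame_lin M a i : tame (lin M a i).
Proof. by have [] := smooth_lin M a i. Qed.

Lemma tame_bil M a b : tame (bil M a b).
Proof.
by apply: tame_sum => i; apply: tameM; [exact: tame_coord|exact: tame_lin].
Qed.

End forms.

Ltac tame_tac := repeat first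
  [ exact: tame_cst | exact: tame_bil | exact: tame_lin | exact: tame_coord | assumption
  | apply: tame_norm | apply: tameX | apply: tameB | apply: tameD | apply: tameN
  | apply: tameM | apply: tame_sum => ? ].

(** * Moments of quadratic forms by integration by parts *)

Section moments.
Context d (T : measurableType d) {R : realType} (P : probability T R).
Variables (r : R) (n : nat) (Z : 'I_n -> {mfun T >-> (R * R)%type}).
Hypothesis r1 : `|r| < 1.
Hypothesis indep : forall A : 'I_n -> set (R * R), (forall i, measurable (A i)) ->
  P (\big[setI/[set: T]]_i (Z i @^-1` A i)) = (\prod_i P (Z i @^-1` A i))%E.
Hypothesis gaussian : forall i, centered_gaussian2 (corr_mx r) (distribution P (Z i)).
Local Notation Ex := (Ex P Z).
Implicit Types (M : 'I_n -> 'I_n -> R).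

(** Integration by parts in each factor [c (a, i)]: the derivative that hits [lin M b i] leaves the
    diagonal entry, hence the trace, and the one that hits [psi] leaves the sum. *)
Lemma Ex_bilM M a b psi dpsi : smooth psi dpsi ->
  Ex (fun c => bil M a b c * psi c) = corr r a b * mxtr M * Ex psi +
  Ex (fun c => \sum_i lin M b i c *
        (corr r a false * dpsi (false, i) c + corr r a true * dpsi (true, i) c)).
Proof.
move=> spsi; have [tpsi tdpsi _ _] := spsi.
have tl i e : tame (fun c => lin M b i c * dpsi (e, i) c) by tame_tac; exact: tdpsi.
have step i : Ex (fun c => c (a, i) * (lin M b i c * psi c)) =
    corr r a b * M i i * Ex psi + Ex (fun c => lin M b i c *
        (corr r a false * dpsi (false, i) c + corr r a true * dpsi (true, i) c)).
  rewrite (Ex_ibp r1 indep gaussian _ _ (smoothM (smooth_lin M b i) spsi)) /=.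
  rewrite !(ExD r1 gaussian)//; try by tame_tac; exact: tdpsi.
  have -> : Ex (fun c => lin M b i c *
        (corr r a false * dpsi (false, i) c + corr r a true * dpsi (true, i) c)) =
     corr r a false * Ex (fun c => lin M b i c * dpsi (false, i) c) +
     corr r a true * Ex (fun c => lin M b i c * dpsi (true, i) c).
    rewrite -!(ExZ r1 gaussian)// -(ExD r1 gaussian)//; try by tame_tac; exact: tdpsi.
    by apply: eq_Ex => c; ring.
  rewrite !(ExZ r1 gaussian)//.
  by move: tl => _; rewrite /corr; case: a; case: b => /=; ring.
transitivity (Ex (fun c => \sum_i c (a, i) * (lin M b i c * psi c))).
  by apply: eq_Ex => c; rewrite /bil mulr_suml; apply: eq_bigr => i _; ring.
rewrite (Ex_sum r1 gaussian); last by move=> i; tame_tac.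
under eq_bigr do rewrite step.
rewrite big_split/= -mulr_suml -mulr_sumr; congr (_ + _).
by rewrite (Ex_sum r1 gaussian)// => i; tame_tac; exact: tdpsi.
Qed.

Lemma Ex_bil M a b : Ex (bil M a b) = corr r a b * mxtr M.
Proof.
have := Ex_bilM M a b (smooth_cst 1); rewrite Ex_cst mulr1.
have -> : Ex (fun c => bil M a b c * 1) = Ex (bil M a b).
  by apply: eq_Ex => c; rewrite mulr1.
move=> ->; rewrite -[RHS]addr0; congr (_ + _); rewrite -[RHS](Ex_cst P Z 0).
by apply: eq_Ex => c; rewrite big1// => i _; ring.
Qed.

(** [Ex_bilM] with the form itself as [psi]: the remainder is [bil (mxsq M) b b + corr r a b * bil
    (mxsq M) a b], whose mean is given by [Ex_bil]. *)
Lemma variance_bil M a b : (forall i j, M i j = M j i) ->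
  Ex (fun c => (bil M a b c - corr r a b * mxtr M) ^+ 2) =
  (1 + corr r a b ^+ 2) * mxtr (mxsq M).
Proof.
move=> sM; have E2 : Ex (fun c => bil M a b c * bil M a b c) =
    (corr r a b * mxtr M) ^+ 2 + (1 + corr r a b ^+ 2) * mxtr (mxsq M).
  rewrite (Ex_bilM _ _ _ (smooth_bil a b sM)) Ex_bil.
  rewrite expr2 mulrA; congr (_ + _).
  have -> : Ex (fun c => \sum_i lin M b i c *
      (corr r a false * ((false == a)%:R * lin M b i c + (false == b)%:R * lin M a i c) +
       corr r a true * ((true == a)%:R * lin M b i c + (true == b)%:R * lin M a i c))) =
    Ex (fun c => bil (mxsq M) b b c + corr r a b * bil (mxsq M) a b c).
    apply: eq_Ex => c; rewrite -!sum_lin_lin// mulr_sumr -big_split/=.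
    by apply: eq_bigr => i _; rewrite /corr; case: a; case: b => /=; ring.
  rewrite (ExD r1 gaussian) ?(ExZ r1 gaussian)//; try by tame_tac.
  rewrite !Ex_bil /corr eqxx; ring.
have -> : Ex (fun c => (bil M a b c - corr r a b * mxtr M) ^+ 2) =
   Ex (fun c => bil M a b c * bil M a b c - 2 * (corr r a b * mxtr M) * bil M a b c +
     (corr r a b * mxtr M) ^+ 2).
  by apply: eq_Ex => c; ring.
rewrite (ExD r1 gaussian); try by tame_tac.
rewrite (ExB r1 gaussian); try by tame_tac.
rewrite (ExZ r1 gaussian); try by tame_tac.
rewrite Ex_cst E2 Ex_bil; ring.
Qed.

(** Pointwise |x| <= (x^2 / t + t) / 2. With [t] of the order of the root mean square this has the
    strength of the Cauchy-Schwarz inequality. *)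
Lemma Ex_norm_le phi (t : R) : 0 < t -> tame phi ->
  Ex (fun c => `|phi c|) <= (Ex (fun c => phi c ^+ 2) / t + t) / 2.
Proof.
move=> t0 tphi.
have -> : (Ex (fun c => phi c ^+ 2) / t + t) / 2 =
    Ex (fun c => (2 * t)^-1 * phi c ^+ 2 + t / 2).
  rewrite (ExD r1 gaussian); try by tame_tac.
  rewrite (ExZ r1 gaussian _ (tameX 2 tphi)).
  by rewrite Ex_cst; field; rewrite gt_eqF.
apply: (le_Ex r1 gaussian); try by tame_tac.
move=> c; rewrite -(real_normK (num_real (phi c))).
have := sqr_ge0 (`|phi c| - t); set x := `|phi c| => h.
rewrite -subr_ge0.
have -> : (2 * t)^-1 * x ^+ 2 + t / 2 - x = (x - t) ^+ 2 / (2 * t) by field; rewrite gt_eqF.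
by rewrite divr_ge0// mulr_ge0// ltW.
Qed.

End moments.

(** * Stein's equation for the standard normal law *)

Section stein.
Context {R : realType}.
Local Notation mu := (@lebesgue_measure R).

Definition gaussd (x : R) : R := normal_pdf 0 1 x.

Lemma gaussdE x : gaussd x = normal_peak 1 * expR (- (x ^+ 2 / 2)).
Proof.
rewrite /gaussd normal_pdfE ?oner_neq0//; congr (_ * expR _).
by rewrite subr0 expr1n mulNr.
Qed.

Lemma gaussd_gt0 x : 0 < gaussd x.
Proof. by rewrite gaussdE mulr_gt0 ?expR_gt0// normal_peak_gt0 ?oner_neq0. Qed.

Let peak1 : normal_peak 1 <= 1 :> R.
Proof.
rewrite /normal_peak invf_le1 ?sqrtr_gt0; last first.
  by rewrite expr1n mul1r mulrn_wgt0// pi_gt0.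
rewrite -[leLHS]sqrtr1 ler_wsqrtr// expr1n mul1r -mulr_natr.
by have := @pi_ge2 R; lra.
Qed.

Lemma gaussd_le1 x : gaussd x <= 1.
Proof. by rewrite (le_trans (normal_pdf_ub _ _ _))// oner_neq0. Qed.

Lemma continuous_gaussd : continuous gaussd.
Proof. by apply: continuous_normal_pdf; rewrite oner_neq0. Qed.

Lemma is_derive_gaussd (x : R) : is_derive x 1 gaussd (- x * gaussd x).
Proof.
rewrite gaussdE (_ : gaussd = normal_peak 1 *: (expR \o (fun t : R => - (t ^+ 2 / 2)))); last first.
  by apply/funext => t; rewrite gaussdE.
have dq : is_derive x 1 (fun t : R => - (t ^+ 2 / 2)) (- x).
  by apply: is_derive_eq; rewrite /GRing.scale/=; field.
have de := @is_derive1_comp _ expR (fun t : R => - (t ^+ 2 / 2)) x _ _ (is_derive_expR _) dq.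
apply: (is_derive_eq (is_deriveZ _ de)).
by rewrite /GRing.scale/=; ring.
Qed.

Lemma integrable_gaussd : mu.-integrable setT (EFin \o gaussd).
Proof. exact: integrable_normal_pdf. Qed.

Let igD D : measurable D -> mu.-integrable D (EFin \o gaussd).
Proof. by move=> mD; apply: integrableS integrable_gaussd. Qed.

Definition gausscdf (x : R) : R := \int[mu]_(t in `]-oo, x]) gaussd t.

Lemma normal_prob_ray (x : R) : normal_prob 0 1 `]-oo, x] = (gausscdf x)%:E.
Proof.
rewrite /gausscdf /Rintegral fineK//; apply: integrable_fin_num => //.
exact: igD.
Qed.

Lemma Rintegral_gaussd : \int[mu]_t gaussd t = 1.
Proof. by rewrite /Rintegral integral_normal_pdf. Qed.

Let ray_split (f : R -> R) (x : R) : mu.-integrable setT (EFin \o f) ->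
  \int[mu]_t f t = \int[mu]_(t in `]-oo, x]) f t + \int[mu]_(t in `[x, +oo[) f t.
Proof.
move=> fi.
have -> : [set: R] = `]-oo, x] `|` `]x, +oo[.
  by apply/seteqP; split => // t _ /=; rewrite !in_itv/= andbT; case: (leP t x); [left|right].
rewrite Rintegral_setU//; last 2 first.
- by apply: integrableS fi => //; exact: measurableU.
- by apply/disj_setPS => t /=; rewrite !in_itv/= andbT => -[/le_lt_trans h /h]; rewrite ltxx.
congr (_ + _); apply: Rintegral_itv_obnd_cbnd.
by apply: integrableS fi.
Qed.

Lemma gausscdf_compl x : 1 - gausscdf x = \int[mu]_(t in `[x, +oo[) gaussd t.
Proof. by rewrite -Rintegral_gaussd (ray_split x integrable_gaussd) addrAC subrr add0r. Qed.

Lemma gausscdf_ge0 x : 0 <= gausscdf x.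
Proof. by apply: Rintegral_ge0 => t _; exact/ltW/gaussd_gt0. Qed.

Lemma gausscdf_le1 x : gausscdf x <= 1.
Proof.
rewrite -subr_ge0 gausscdf_compl; apply: Rintegral_ge0 => t _; exact/ltW/gaussd_gt0.
Qed.

Lemma gausscdf_lipschitz (x e : R) : 0 <= e -> gausscdf (x + e) <= gausscdf x + e.
Proof.
move=> e0; rewrite /gausscdf.
have -> : [set` `]-oo, x + e]] = `]-oo, x] `|` `]x, x + e] :> set R.
  rewrite [RHS]setUC; apply/seteqP; split => t /=; rewrite !in_itv/=.
    by move=> te; case: (leP t x) => tx; [right|left].
  by move=> [/andP[]//|/le_trans]; apply; rewrite lerDl.
rewrite Rintegral_setU//; last 2 first.
- by apply: igD; exact: measurableU.
- apply/disj_setPS => t /=; rewrite !in_itv/= => -[/le_lt_trans h /andP[/h]].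
  by rewrite ltxx.
rewrite lerD2l.
rewrite /Rintegral -lee_fin fineK; last by apply: integrable_fin_num => //; exact: igD.
have h : (\int[mu]_(t in `]x, (x + e)%R]) (gaussd t)%:E <=
    \int[mu]_(t in `]x, (x + e)%R]) (cst 1%:E) t)%E.
  apply: ge0_le_integral => //=.
  - by move=> t _; rewrite lee_fin ltW// gaussd_gt0.
  - by have /integrableP[] := igD (measurable_itv `]x, x + e]).
  - by move=> t _; rewrite lee_fin gaussd_le1.
apply: (le_trans h).
rewrite integral_cst//= mul1e lebesgue_measure_itv/= lte_fin.
case: ifPn => _; last by rewrite lee_fin.
by rewrite -EFinB lee_fin addrAC subrr add0r.
Qed.

Let cvg_gaussd : gaussd x @[x --> +oo%R] --> (0 : R).
Proof.
apply/cvgrPdist_le => e e0; near=> x.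
have x0 : 0 < x by near: x; exact: nbhs_pinfty_gt.
rewrite sub0r normrN ger0_norm ?(ltW (gaussd_gt0 _))//.
apply: (@le_trans _ _ (expR (- (x ^+ 2 / 2)))).
  by rewrite gaussdE ler_piMl// expR_ge0.
rewrite expRN invf_ple ?posrE ?expR_gt0//.
apply: (le_trans _ (expR_ge1Dx _)).
have h : e^-1 <= x by near: x; apply: nbhs_pinfty_ge; rewrite num_real.
have := sqr_ge0 (x - 1); rewrite sqrrB1; lra.
Unshelve. all: by end_near. Qed.

(** Mills' inequality: on the ray the factor [x] is at most [t], and [t * gaussd t] is the
    derivative of [- gaussd]. *)
Lemma mills_right (x : R) : 0 < x -> x * (1 - gausscdf x) <= gaussd x.
Proof.
move=> x0; rewrite gausscdf_compl.
have h : (\int[mu]_(t in `[x, +oo[) (t * gaussd t)%:E = 0%:E - (- gaussd x)%:E)%E.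
  apply: (@ge0_continuous_FTC2y R _ (fun t => - gaussd t)).
  - by move=> t xt; rewrite mulr_ge0 ?(ltW (gaussd_gt0 _))// (le_trans (ltW x0)).
  - apply: continuous_subspaceT => t; apply: cvgM; first exact: cvg_id.
    exact: continuous_gaussd.
  - by rewrite -oppr0; apply: cvgN; exact: cvg_gaussd.
  - by move=> t _; have [] := is_deriveN (is_derive_gaussd t).
  - by apply: cvg_at_right_filter; apply: cvgN; exact: continuous_gaussd.
  - move=> t _; rewrite derive1E.
    by rewrite (@derive_val _ _ _ _ _ _ _ (is_deriveN (is_derive_gaussd t))) mulNr opprK.
rewrite -[leRHS]opprK -[leRHS]add0r -lee_fin EFinB -h.
rewrite -RintegralZl//; last exact: igD.
rewrite /Rintegral fineK; last first.
  apply: integrable_fin_num => //=.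
  have mx : measurable (`[x, +oo[ : set R) by exact: measurable_itv.
  exact: (@integrableZl _ _ _ mu _ mx x (EFin \o gaussd) (igD mx)).
apply: ge0_le_integral => //=.
- by move=> t _; rewrite lee_fin mulr_ge0 ?ltW ?gaussd_gt0.
- apply/measurable_EFinP; apply: measurable_funTS; apply: measurable_funM => //.
  exact: measurable_normal_pdf.
- apply/measurable_EFinP; apply: measurable_funTS; apply: measurable_funM => //.
  exact: measurable_normal_pdf.
- move=> t; rewrite in_itv/= andbT => xt; rewrite lee_fin ler_wpM2r//.
  exact/ltW/gaussd_gt0.
Qed.

Lemma gaussdN x : gaussd (- x) = gaussd x.
Proof. by rewrite !gaussdE sqrrN. Qed.

Lemma gausscdfN x : gausscdf (- x) = 1 - gausscdf x.
Proof.
rewrite gausscdf_compl /gausscdf /Rintegral; congr fine.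
rewrite ge0_integration_by_substitutionNy//=.
- by apply: eq_integral => t _; rewrite /= gaussdN.
- by apply: continuous_subspaceT; exact: continuous_gaussd.
- by move=> t _; exact/ltW/gaussd_gt0.
Qed.

Lemma mills_left (x : R) : x < 0 -> - x * gausscdf x <= gaussd x.
Proof.
move=> x0; have := @mills_right (- x); rewrite oppr_gt0 => /(_ x0).
by rewrite gausscdfN gaussdN opprB addrC subrK.
Qed.

(** * The bounded solution of Stein's equation for a continuous test function *)

Section solution.
Variable h : R -> R.
Hypotheses (ch : continuous h) (h01 : forall x, 0 <= h x <= 1).

Definition gaussmean : R := \int[mu]_t (h t * gaussd t).

Let g t := (h t - gaussmean) * gaussd t.

Let mh : measurable_fun setT h. Proof. exact: continuous_measurable_fun. Qed.

Let mg0 : measurable_fun setT gaussd.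
Proof. exact: measurable_normal_pdf. Qed.

Let ihg : mu.-integrable setT (EFin \o (fun t => h t * gaussd t)).
Proof.
apply: (le_integrable measurableT _ _ integrable_gaussd).
  by apply/measurable_EFinP; exact: measurable_funM.
move=> t _ /=; rewrite lee_fin normrM ler_piMl//.
by rewrite ger0_norm; have /andP[] := h01 t.
Qed.

Let Nh01 : 0 <= gaussmean <= 1.
Proof.
apply/andP; split.
  apply: Rintegral_ge0 => t _; rewrite mulr_ge0 ?(ltW (gaussd_gt0 _))//.
  by have /andP[] := h01 t.
rewrite -Rintegral_gaussd; apply: le_Rintegral => //; first exact: integrable_gaussd.
by move=> t _; rewrite ler_piMl ?(ltW (gaussd_gt0 _))//; have /andP[] := h01 t.
Qed.

Let hN t : `|h t - gaussmean| <= 1.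
Proof.
by have := Nh01; have := h01 t; rewrite ler_norml; lra.
Qed.

Let gle t : `|g t| <= gaussd t.
Proof.
rewrite /g normrM (ger0_norm (ltW (gaussd_gt0 _))) ler_piMl//; exact/ltW/gaussd_gt0.
Qed.

Let ig : mu.-integrable setT (EFin \o g).
Proof.
apply: (le_integrable measurableT _ _ integrable_gaussd).
  by apply/measurable_EFinP; apply: measurable_funM => //; exact: measurable_funB.
move=> t _ /=; rewrite lee_fin (le_trans (gle t))// ler_norm//.
Qed.

Let int_g0 : \int[mu]_t g t = 0.
Proof.
rewrite (_ : \int[mu]_t g t = \int[mu]_t (h t * gaussd t - gaussmean * gaussd t)); last first.
  by apply: eq_Rintegral => t _; rewrite /g mulrBl.
rewrite RintegralB//; last exact: (integrableZl measurableT gaussmean integrable_gaussd).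
by rewrite RintegralZl ?Rintegral_gaussd ?mulr1 ?subrr//; exact: integrable_gaussd.
Qed.

Let G x := \int[mu]_(t in `]-oo, x]) g t.

Let cg : continuous g.
Proof.
move=> t; apply: cvgM; last exact: continuous_gaussd.
by apply: cvgB; [exact: ch|exact: cvg_cst].
Qed.

Let igS D : measurable D -> mu.-integrable D (EFin \o g).
Proof. by move=> mD; apply: integrableS ig. Qed.

Let dG (x : R) : is_derive x 1 G (g x).
Proof.
have xx1 : x < x + 1 by rewrite ltrDl.
have igx : mu.-integrable [set` Interval -oo%O (BRight (x + 1))] (EFin \o g).
  exact: igS.
have xoo : (-oo%O < BRight x)%E by exact: (ltNyr x).
have [dGx Gx] := continuous_FTC1 xx1 igx xoo (@cg x).
by split => //; rewrite -derive1E.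
Qed.

Let Gle1 x : `|G x| <= gausscdf x.
Proof.
apply: (le_trans (le_normr_Rintegral _ _)) => //; first exact: igS.
apply: le_Rintegral => //; [|exact: igD].
by apply: integrable_norm; exact: igS.
Qed.

(** As [g] has integral 0, [G] is also minus the integral over the other ray. This gives the small
    bound for positive [x], as [Gle1] does for negative [x]. *)
Let Gle2 x : `|G x| <= 1 - gausscdf x.
Proof.
have -> : G x = - \int[mu]_(t in `[x, +oo[) g t.
  by apply/eqP; rewrite -addr_eq0 -ray_split// int_g0.
rewrite normrN gausscdf_compl; apply: (le_trans (le_normr_Rintegral _ _)) => //.
  exact: igS.
apply: le_Rintegral => //; [|exact: igD].
by apply: integrable_norm; exact: igS.
Qed.

Definition stein_sol x : R := G x / gaussd x.
(** Stein's equation, read as a formula for the derivative. *)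
Definition stein_der x : R := x * stein_sol x + (h x - gaussmean).

Lemma is_derive_stein_sol (x : R) : is_derive x 1 stein_sol (stein_der x).
Proof.
have g0 : gaussd x != 0 by rewrite gt_eqF ?gaussd_gt0.
have dV := is_deriveV g0 (is_derive_gaussd x).
apply: (is_derive_eq (is_deriveM (dG x) dV)).
rewrite /GRing.scale/= /stein_der /stein_sol /g /=.
by field.
Qed.

Lemma norm_x_stein_sol (x : R) : `|x * stein_sol x| <= 1.
Proof.
rewrite /stein_sol mulrA normrM normfV (gtr0_norm (gaussd_gt0 x)).
rewrite ler_pdivrMr ?gaussd_gt0// mul1r normrM.
have [x0|x0|->] := ltgtP x 0.
- rewrite ltr0_norm//; apply: le_trans (mills_left x0).
  by rewrite ler_wpM2l// oppr_ge0 ltW.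
- rewrite gtr0_norm//; apply: le_trans (mills_right x0).
  by rewrite ler_wpM2l// ltW.
- by rewrite normr0 mul0r ltW ?gaussd_gt0.
Qed.

Lemma norm_stein_der x : `|stein_der x| <= 2.
Proof.
rewrite (le_trans (ler_normD _ _))// -[leRHS]/(1 + 1 : R).
by rewrite lerD ?norm_x_stein_sol.
Qed.

(** The fraction is the maximum of 1 / [gaussd] on [-1, 1]. The summand 1 serves |x| > 1, where the
    solution is at most |x| times itself in absolute value. The test function does not enter. *)
Definition stein_bound : R := 1 + expR (1 / 2) / normal_peak 1.

Lemma norm_stein_sol x : `|stein_sol x| <= stein_bound.
Proof.
have p0 : 0 < normal_peak 1 :> R by rewrite normal_peak_gt0 ?oner_neq0.
have [x1|x1] := leP `|x| 1.
  rewrite /stein_sol normrM normfV (gtr0_norm (gaussd_gt0 x)).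
  apply: (@le_trans _ _ (expR (1 / 2) / normal_peak 1)); last by rewrite lerDr.
  have hG : `|G x| <= 1 by exact: (le_trans (Gle1 x) (gausscdf_le1 x)).
  have hE : expR (x ^+ 2 / 2) <= expR (1 / 2).
    rewrite ler_expR ler_pM2r// -real_normK ?num_real//.
    by rewrite expr_le1.
  rewrite gaussdE invfM -expRN opprK mulrCA [leRHS]mulrC.
  rewrite ler_wpM2l ?invr_ge0 ?(ltW p0)//.
  rewrite -[leRHS]mul1r; apply: ler_pM => //; exact: expR_ge0.
apply: (@le_trans _ _ 1); last by rewrite lerDl divr_ge0 ?expR_ge0// ltW.
apply: le_trans (norm_x_stein_sol x); rewrite [leRHS]normrM.
by rewrite ler_peMl// ltW.
Qed.

Lemma continuous_stein_der : continuous stein_der.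
Proof.
move=> x; apply: cvgD; last by apply: cvgB; [exact: ch|exact: cvg_cst].
apply: cvgM; first exact: cvg_id.
apply/differentiable_continuous/derivable1_diffP.
by have [] := is_derive_stein_sol x.
Qed.

End solution.
End stein.

(** * The linearized statistic *)

Section bound.
Context d (T : measurableType d) {R : realType} (P : probability T R).
Variables (r : R) (n : nat) (Z : 'I_n -> {mfun T >-> (R * R)%type}).
Hypothesis r1 : `|r| < 1.
Hypothesis indep : forall A : 'I_n -> set (R * R), (forall i, measurable (A i)) ->
  P (\big[setI/[set: T]]_i (Z i @^-1` A i)) = (\prod_i P (Z i @^-1` A i))%E.
Hypothesis gaussian : forall i, centered_gaussian2 (corr_mx r) (distribution P (Z i)).
Local Notation Ex := (Ex P Z).
Local Notation J := (bool * 'I_n)%type.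

Variables (S : 'I_n -> 'I_n -> R) (v w K kappa : R).
Hypotheses (sS : forall i j, S i j = S j i) (n0 : (0 < n)%N) (v0 : 0 < v) (w0 : 0 < w)
  (K0 : 0 <= K).
Hypotheses (rowS : forall i, \sum_j `|S i j| <= K / n%:R)
  (trS : `|mxtr S - v| <= K / n%:R) (trS2 : `|n%:R * mxtr (mxsq S) - w| <= K / n%:R).

Let s : R := Num.sqrt n%:R.
Let p : R := 1 - r ^+ 2.
(** The centred form Z12 - (r/2)(Z11 + Z22) has variance p^2 tr S^2, which is close to p^2 w / n;
    [tau] normalizes it. *)
Let tau : R := s / (p * Num.sqrt w).

Let nR : 0 < n%:R :> R. Proof. by rewrite ltr0n. Qed.
Let s0 : 0 < s. Proof. by rewrite sqrtr_gt0. Qed.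
Let sE : s ^+ 2 = n%:R. Proof. by rewrite sqr_sqrtr// ltW. Qed.
Let s1 : 1 <= s. Proof. by rewrite -[leLHS]sqrtr1 ler_wsqrtr// ler1n. Qed.
Let p0 : 0 < p. Proof. by rewrite subr_gt0 -real_normK ?num_real// expr_lt1. Qed.
Let sw0 : 0 < Num.sqrt w. Proof. by rewrite sqrtr_gt0. Qed.
Let swE : Num.sqrt w ^+ 2 = w. Proof. by rewrite sqr_sqrtr// ltW. Qed.

Local Notation q a b := (bil S a b).
Local Notation Q a b := (bil (mxsq S) a b).
Let t := mxtr S.
Let t2 := mxtr (mxsq S).

Let sS2 := mxsqC sS.

Let t2_le : t2 <= K ^+ 2 / n%:R.
Proof.
apply: (le_trans (mxtr_mxsq_le sS rowS)).
rewrite le_eqVlt; apply/orP; left; apply/eqP; field; by rewrite gt_eqF.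
Qed.

Let t4_le : mxtr (mxsq (mxsq S)) <= K ^+ 4 / n%:R ^+ 3.
Proof.
apply: (le_trans (mxtr_mxsq_le sS2 (row_sum_mxsq rowS))).
rewrite le_eqVlt; apply/orP; left; apply/eqP; field; by rewrite gt_eqF.
Qed.

Let corr_sqr a b : corr r a b ^+ 2 <= 1.
Proof.
rewrite /corr; case: ifP => _; first by rewrite expr1n.
by rewrite -real_normK ?num_real// expr_le1// ltW.
Qed.

Lemma Ex_norm_bil a : Ex (fun c => `|q a a c - t|) <= (K ^+ 2 + 1) / s.
Proof.
have tq : tame (fun c => q a a c - t) by tame_tac.
(* The variance is 2 tr S^2 = O(1/n), whence this choice of [t]. *)
apply: (le_trans (Ex_norm_le r1 gaussian (t := s^-1) _ tq)); first by rewrite invr_gt0.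
have -> : Ex (fun c => (q a a c - t) ^+ 2) = 2 * t2.
  have := variance_bil r1 indep gaussian a a sS.
  by rewrite /corr eqxx mul1r expr1n => ->.
rewrite invrK mulrAC ler_pdivrMr// -[leRHS]mulrAC.
have h : 2 * t2 * s <= 2 * (K ^+ 2 / s).
  rewrite -mulrA ler_wpM2l//.
  have -> : K ^+ 2 / s = K ^+ 2 / n%:R * s by rewrite -sE; field; rewrite gt_eqF.
  by rewrite ler_wpM2r// ltW.
have h1 : 0 < s^-1 by rewrite invr_gt0.
have -> : (K ^+ 2 + 1) * 2 / s = 2 * (K ^+ 2 / s) + 2 * s^-1 by ring.
lra.
Qed.

Lemma Ex_sqr_diff : Ex (fun c => (q false false c - q true true c) ^+ 2) <= 8 * K ^+ 2 / n%:R.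
Proof.
have V a : Ex (fun c => (q a a c - t) ^+ 2) = 2 * t2.
  have := variance_bil r1 indep gaussian a a sS.
  by rewrite /corr eqxx mul1r expr1n => ->.
have tq a : tame (fun c => (q a a c - t) ^+ 2) by tame_tac.
apply: (@le_trans _ _ (Ex (fun c => 2 * (q false false c - t) ^+ 2 + 2 * (q true true c - t) ^+ 2))).
  apply: (le_Ex r1 gaussian); try by tame_tac.
  move=> c; rewrite -subr_ge0; set x := q false false c; set y := q true true c.
  have -> : 2 * (x - t) ^+ 2 + 2 * (y - t) ^+ 2 - (x - y) ^+ 2 = (x + y - 2 * t) ^+ 2.
    by ring.
  exact: sqr_ge0.
rewrite (ExD r1 gaussian); try by tame_tac.
rewrite !(ExZ r1 gaussian)// !V -mulrA; have := t2_le; lra.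
Qed.

Lemma Ex_norm_bil2 a b : Ex (fun c => `|Q a b c - corr r a b * t2|) <= (K ^+ 4 + 1) / (n%:R * s).
Proof.
have tq : tame (fun c => Q a b c - corr r a b * t2) by tame_tac.
have ns0 : 0 < n%:R * s by rewrite mulr_gt0.
(* Here the variance is governed by tr S^4 = O(n^-3): the form fluctuates on the scale 1 / (n s), a
   factor 1 / s below the order 1 / n of tr S^2. *)
apply: (le_trans (Ex_norm_le r1 gaussian (t := (n%:R * s)^-1) _ tq)); first by rewrite invr_gt0.
rewrite (variance_bil r1 indep gaussian _ _ sS2) invrK.
have h : (1 + corr r a b ^+ 2) * mxtr (mxsq (mxsq S)) * (n%:R * s) <= 2 * (K ^+ 4 / (n%:R * s)).
  have -> : 2 * (K ^+ 4 / (n%:R * s)) = 2 * (K ^+ 4 / n%:R ^+ 3) * (n%:R * s).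
    by rewrite -sE; field; rewrite gt_eqF.
  rewrite ler_wpM2r ?(ltW ns0)//; apply: ler_pM.
  - by rewrite addr_ge0// sqr_ge0.
  - exact: mxtr_mxsq_ge0.
  - by have := corr_sqr a b; lra.
  - exact: t4_le.
have h1 : 0 < (n%:R * s)^-1 by rewrite invr_gt0.
rewrite [leRHS]mulrDl mul1r; lra.
Qed.

(** This uncentred bound serves the term of [1 - tau * Gam] whose coefficient is of order |z| s: the
    product is already O(|z| / s). The cross term is dominated by squares through 2 |x y| <= x^2 +
    y^2. *)
Lemma Ex_norm_cross : Ex (fun c => `|Q false true c|) <= K ^+ 2 / n%:R.
Proof.
apply: (@le_trans _ _ (Ex (fun c => 2^-1 * Q false false c + 2^-1 * Q true true c))).
  apply: (le_Ex r1 gaussian); try by tame_tac.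
  move=> c; rewrite -!sum_lin_lin// !mulr_sumr -big_split/=.
  rewrite (le_trans (ler_norm_sum _ _ _))// ler_sum// => i _.
  set x := lin _ _ _ _; set y := lin _ _ _ _.
  have := sqr_ge0 (x - y); have := sqr_ge0 (x + y).
  rewrite ler_norml !sqrrD sqrrN -!expr2 mulrN; lra.
rewrite (ExD r1 gaussian); try by tame_tac.
rewrite !(ExZ r1 gaussian); try by tame_tac.
rewrite !(Ex_bil r1 indep gaussian) /corr !eqxx; have := t2_le; rewrite /t2; lra.
Qed.

Variable z : R.

(* In terms of the empirical covariances [Zab = bil S a b], [stat <= z] is
   [Z12 <= c * (Z11 + Z22) / 2] multiplied by [tau], for the threshold
   [c = r + z / (tau * v)] of the correlation, with a correction proportional
   to [(Z11 - Z22) ^+ 2]. *)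
Definition stat (c : J -> R) : R :=
  tau * (q false true c + - (r / 2) * (q false false c + q true true c)) +
  z * (1 + - (2 * v)^-1 * (q false false c + q true true c)) +
  kappa * s * ((q false false c + -1 * q true true c) * (q false false c + -1 * q true true c)).

(* The correction term drops out: its gradient is orthogonal to the field used
   in the integration by parts. *)
Lemma smooth_stat : exists2 dF, smooth stat dF & forall i c,
  lin S true i c * dF (false, i) c + lin S false i c * dF (true, i) c =
  tau * (lin S false i c ^+ 2 + lin S true i c ^+ 2 - 2 * r * (lin S false i c * lin S true i c))
  - 2 * z / v * (lin S false i c * lin S true i c).
Proof.
have q00 := smooth_bil false false sS; have q11 := smooth_bil true true sS.
have q01 := smooth_bil false true sS.
have D := smoothD q00 (smoothZ (-1) q11).
eexists.
  exact: (smoothD (smoothD (smoothZ tau (smoothD q01 (smoothZ (- (r / 2)) (smoothD q00 q11))))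
    (smoothZ z (smoothD (smooth_cst 1) (smoothZ (- (2 * v)^-1) (smoothD q00 q11)))))
    (smoothZ (kappa * s) (smoothM D D))).
by move=> i c /=; field; rewrite gt_eqF.
Qed.

Let M c := q false true c + - (r / 2) * (q false false c + q true true c).
Let eps c := z * (1 + - (2 * v)^-1 * (q false false c + q true true c)) +
  kappa * s * ((q false false c + -1 * q true true c) * (q false false c + -1 * q true true c)).
(** p / 2 times the derivative of [stat] along the field (S xi, S eta swapped), that is along (S
    eta, S xi); [tau * Gam] is the form g of the overview. *)
Let Gam c := p / 2 * (tau * (Q false false c + Q true true c - 2 * r * Q false true c)
   - 2 * z / v * Q false true c).

Variable h : R -> R.
Hypotheses (ch : continuous h) (h01 : forall x, 0 <= h x <= 1).

Let f := stein_sol h.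
Let df := stein_der h.

Let tame_stat : tame stat. Proof. by have [dF []] := smooth_stat. Qed.

Let tame_df : tame (fun c => df (stat c)).
Proof.
apply: (@tame_comp _ _ df 2) => //.
  exact: (continuous_measurable_fun (continuous_stein_der ch h01)).
move=> x; rewrite (le_trans (norm_stein_der ch h01 x))//.
by rewrite ler_peMr// lerDl.
Qed.

Let sb0 : 0 <= stein_bound :> R.
Proof. exact: le_trans (normr_ge0 _) (norm_stein_sol ch h01 0). Qed.

Let tame_f : tame (fun c => f (stat c)).
Proof.
apply: (@tame_comp _ _ f stein_bound) => //.
  apply: continuous_measurable_fun => x.
  apply/differentiable_continuous/derivable1_diffP.
  by have [] := is_derive_stein_sol ch h01 x.
move=> x; rewrite (le_trans (norm_stein_sol ch h01 x))//.
by rewrite ler_peMr// lerDl.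
Qed.

(** The weights in [M] are exactly those for which the traces cancel and the four remainders combine
    into one field. *)
Lemma Ex_stein_ibp : Ex (fun c => M c * f (stat c)) = Ex (fun c => df (stat c) * Gam c).
Proof.
have [dF sF dFE] := smooth_stat.
have kb (x : R) : stein_bound + 2 <= (stein_bound + 2) * (1 + `|x|).
  have sb2 : 0 <= stein_bound + 2 :> R by exact: addr_ge0.
  by rewrite ler_peMr// lerDl.
have sf : smooth (fun c => f (stat c)) (fun j c => df (stat c) * dF j c).
  apply: (@smooth_comp _ _ f df (stein_bound + 2)) => //.
  - exact: is_derive_stein_sol.
  - exact: continuous_stein_der.
  - move=> x; apply: le_trans (kb x); apply: (le_trans (norm_stein_sol ch h01 x)).
    by rewrite lerDl.
  - move=> x; apply: le_trans (kb x); apply: (le_trans (norm_stein_der ch h01 x)).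
    by rewrite lerDr.
have [_ tdF _ _] := sF.
pose G a b c := \sum_i lin S b i c *
   (corr r a false * (df (stat c) * dF (false, i) c) +
    corr r a true * (df (stat c) * dF (true, i) c)).
have tG a b : tame (G a b).
  by rewrite /G; tame_tac => //; exact: tdF.
have E a b : Ex (fun c => q a b c * f (stat c)) =
    corr r a b * t * Ex (fun c => f (stat c)) + Ex (G a b).
  exact: (Ex_bilM r1 indep gaussian S a b sf).
have tE a b : tame (fun c => q a b c * f (stat c)) by tame_tac.
(* Z12 is split evenly between its two orders, so that both components get integrated by parts in
   the same way. *)
have -> : Ex (fun c => M c * f (stat c)) =
  2^-1 * Ex (fun c => q false true c * f (stat c)) +
  2^-1 * Ex (fun c => q true false c * f (stat c)) +
  - (r / 2) * Ex (fun c => q false false c * f (stat c)) +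
  - (r / 2) * Ex (fun c => q true true c * f (stat c)).
  rewrite -!(ExZ r1 gaussian)// -!(ExD r1 gaussian); try by tame_tac.
  by apply: eq_Ex => c; rewrite /M (bilC true false c sS); field.
rewrite !E /corr /=.
(* The trace terms have the coefficients r/2, r/2, -r/2 and -r/2. *)
transitivity (2^-1 * Ex (G false true) + 2^-1 * Ex (G true false) +
   - (r / 2) * Ex (G false false) + - (r / 2) * Ex (G true true)); first by field.
rewrite -!(ExZ r1 gaussian)// -!(ExD r1 gaussian); try by tame_tac.
apply: eq_Ex => c.
have -> : df (stat c) * Gam c = \sum_i df (stat c) * (p / 2 * (tau *
    (lin S false i c * lin S false i c + lin S true i c * lin S true i c -
     2 * r * (lin S false i c * lin S true i c))
    - 2 * z / v * (lin S false i c * lin S true i c))).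
  rewrite -!mulr_sumr sumrB -!mulr_sumr sumrB big_split/= -!mulr_sumr.
  by rewrite !sum_lin_lin.
rewrite /G !mulr_sumr -!big_split/=.
apply: eq_bigr => i _; have := dFE i c; rewrite /corr /=.
set u := lin S false i c; set y := lin S true i c.
set A := dF (false, i) c; set B := dF (true, i) c => e.
(* The products u A and y B cancel, and y A and u B each keep the factor (1 - r^2) / 2. *)
transitivity (df (stat c) * (p / 2 * (y * A + u * B))); first by rewrite /p; field.
by rewrite e; field; rewrite gt_eqF.
Qed.

(** By Stein's equation the left integrand is f' - F f with F = [tau * M + eps]. In expectation
    [tau * M] times f may be traded for f' times [tau * Gam], and f' and f are then replaced by
    their bounds. *)
Lemma norm_Ex_stein : `|Ex (fun c => h (stat c) - gaussmean h)| <=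
  2 * Ex (fun c => `|1 - tau * Gam c|) + stein_bound * Ex (fun c => `|eps c|).
Proof.
have tG : tame Gam by rewrite /Gam; tame_tac.
have te : tame eps by rewrite /eps; tame_tac.
have tM : tame M by rewrite /M; tame_tac.
have -> : Ex (fun c => h (stat c) - gaussmean h) =
    Ex (fun c => df (stat c) * (1 - tau * Gam c) - eps c * f (stat c)).
  transitivity (Ex (fun c => df (stat c) * (1 - tau * Gam c) - eps c * f (stat c)
     + tau * (df (stat c) * Gam c - M c * f (stat c)))).
    apply: eq_Ex => c.
    have -> : h (stat c) - gaussmean h = df (stat c) - stat c * f (stat c).
      by rewrite /df /stein_der addrAC subrr add0r.
    have -> : stat c = tau * M c + eps c by rewrite /stat /M /eps; ring.
    by ring.
  rewrite (ExD r1 gaussian); try by tame_tac.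
  rewrite (ExZ r1 gaussian _ (phi := fun c => df (stat c) * Gam c - M c * f (stat c))); last by tame_tac.
  rewrite (ExB r1 gaussian (phi := fun c => df (stat c) * Gam c)); try by tame_tac.
  by rewrite Ex_stein_ibp subrr mulr0 addr0.
apply: (le_trans (le_norm_Ex r1 gaussian _)); first by tame_tac.
rewrite -!(ExZ r1 gaussian) -?(ExD r1 gaussian); try by tame_tac.
apply: (le_Ex r1 gaussian); try by tame_tac.
move=> c; rewrite (le_trans (ler_normB _ _))//.
rewrite (normrM (df (stat c))) (normrM (eps c)) lerD//.
  by rewrite ler_wpM2r//; exact: (norm_stein_der ch h01).
by rewrite [leLHS]mulrC ler_wpM2r//; exact: (norm_stein_sol ch h01).
Qed.

Lemma Ex_norm_eps : Ex (fun c => `|eps c|) <=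
  (`|z| * ((K + K ^+ 2 + 1) / v) + 8 * `|kappa| * K ^+ 2) / s.
Proof.
have v2 : 0 < (2 * v)^-1 by rewrite invr_gt0 mulr_gt0.
apply: (@le_trans _ _ (Ex (fun c => `|z| * (2 * v)^-1 * (2 * `|t - v| +
   `|q false false c - t| + `|q true true c - t|) +
   `|kappa| * s * (q false false c - q true true c) ^+ 2))).
  apply: (le_Ex r1 gaussian); rewrite /eps; try by tame_tac.
  move=> c; set x := q false false c; set y := q true true c.
  rewrite (le_trans (ler_normD _ _))// lerD//.
    rewrite normrM -mulrA ler_wpM2l//.
    have -> : 1 + - (2 * v)^-1 * (x + y) = (2 * v)^-1 * (- (2 * (t - v) + (x - t) + (y - t))).
      by field; rewrite gt_eqF.
    rewrite normrM normrN (gtr0_norm v2) ler_wpM2l ?(ltW v2)//.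
    rewrite (le_trans (ler_normD _ _))// lerD//.
    by rewrite (le_trans (ler_normD _ _))// normrM ger0_norm.
  rewrite !normrM (gtr0_norm s0) -normrM -expr2 ler_wpM2l ?mulr_ge0//.
    by rewrite ltW.
  by rewrite mulN1r ger0_norm// sqr_ge0.
rewrite (ExD r1 gaussian); try by tame_tac.
rewrite (ExZ r1 gaussian _ (phi := fun c => 2 * `|t - v| +
   `|q false false c - t| + `|q true true c - t|)); last by tame_tac.
rewrite (ExZ r1 gaussian _ (phi := fun c => (q false false c - q true true c) ^+ 2)); last by tame_tac.
rewrite (ExD r1 gaussian); try by tame_tac.
rewrite (ExD r1 gaussian); try by tame_tac.
rewrite Ex_cst [leRHS]mulrDl; apply: lerD.
  have ks : K / n%:R <= K / s.
    by rewrite ler_wpM2l// lef_pV2 ?posrE// -sE expr2 ler_peMr// ltW.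
  have -> : `|z| * ((K + K ^+ 2 + 1) / v) / s =
      `|z| * (2 * v)^-1 * (2 * (K / s + (K ^+ 2 + 1) / s)).
    by field; rewrite !gt_eqF.
  rewrite ler_wpM2l ?mulr_ge0 ?(ltW v2)//.
  have := Ex_norm_bil false; have := Ex_norm_bil true; have := trS; rewrite -/t; lra.
have -> : 8 * `|kappa| * K ^+ 2 / s = `|kappa| * s * (8 * K ^+ 2 / n%:R).
  by rewrite -sE; field; rewrite gt_eqF.
by rewrite ler_wpM2l ?mulr_ge0 ?(ltW s0)// Ex_sqr_diff.
Qed.

Lemma Ex_norm_Gam : Ex (fun c => `|1 - tau * Gam c|) <=
  (K / w + 2 * (K ^+ 4 + 1) / (p * w) + `|z| * (K ^+ 2 / (v * Num.sqrt w))) / s.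
Proof.
(* [c1] is tau^2 p / 2 and [c2] is |z| tau p / v, the coefficients in [tau * Gam]. As 1 + 1 - 2 r^2
   = 2 p, the centring terms multiplied by [c1] add up to n tr S^2 / w, whose distance to 1 is the
   first summand. *)
pose c1 := n%:R / (2 * p * w).
have c10 : 0 < c1 by rewrite divr_gt0// !mulr_gt0.
pose c2 := `|z| * (s / (v * Num.sqrt w)).
have c20 : 0 <= c2 by rewrite mulr_ge0// divr_ge0 ?ltW// mulr_gt0.
have rl1 : `|r| <= 1 by exact: ltW.
apply: (@le_trans _ _ (Ex (fun c => `|n%:R * t2 - w| / w + c1 * (
   `|Q false false c - corr r false false * t2| + `|Q true true c - corr r true true * t2| +
   2 * `|Q false true c - corr r false true * t2|) + c2 * `|Q false true c|))).
  apply: (le_Ex r1 gaussian); rewrite /Gam; try by tame_tac.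
  move=> c; set x := Q false false c; set y := Q true true c; set u := Q false true c.
  rewrite /corr /= !mul1r.
  have -> : 1 - tau * (p / 2 * (tau * (x + y - 2 * r * u) - 2 * z / v * u)) =
     - ((n%:R * t2 - w) / w) - c1 * ((x - t2) + (y - t2) - 2 * (r * (u - r * t2))) +
     z * (s / (v * Num.sqrt w)) * u.
    rewrite /c1 /tau; move: (Num.sqrt w) swE sw0 => sw swE0 sw_gt0.
    move: (p0); rewrite -swE0 -sE /p => p_gt0; field.
    by rewrite !gt_eqF.
  rewrite (le_trans (ler_normD _ _))// lerD//; last first.
    rewrite normrM ler_wpM2r// normrM ler_wpM2l//.
    by rewrite ger0_norm// divr_ge0 ?ltW// mulr_gt0.
  rewrite (le_trans (ler_normB _ _))// lerD//.
    by rewrite normrN normrM normfV (gtr0_norm w0).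
  rewrite normrM (gtr0_norm c10) ler_wpM2l ?(ltW c10)//.
  rewrite (le_trans (ler_normB _ _))// lerD//; first exact: ler_normD.
  rewrite !normrM ger0_norm// ler_wpM2l// ler_piMl//.
rewrite (ExD r1 gaussian); try by tame_tac.
rewrite (ExD r1 gaussian); try by tame_tac.
rewrite Ex_cst.
rewrite (ExZ r1 gaussian _ (phi := fun c => `|Q false false c - corr r false false * t2| +
  `|Q true true c - corr r true true * t2| +
   2 * `|Q false true c - corr r false true * t2|)); last by tame_tac.
rewrite (ExZ r1 gaussian _ (phi := fun c => `|Q false true c|)); last by tame_tac.
rewrite (ExD r1 gaussian); try by tame_tac.
rewrite (ExD r1 gaussian); try by tame_tac.
rewrite (ExZ r1 gaussian _ (phi := fun c => `|Q false true c - corr r false true * t2|)); last by tame_tac.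
have -> : (K / w + 2 * (K ^+ 4 + 1) / (p * w) + `|z| * (K ^+ 2 / (v * Num.sqrt w))) / s =
  K / w / s + c1 * (4 * ((K ^+ 4 + 1) / (n%:R * s))) + c2 * (K ^+ 2 / n%:R).
  by rewrite /c1 /c2 -sE; field; rewrite !gt_eqF.
rewrite !lerD//.
- rewrite mulrAC ler_wpM2r ?invr_ge0 ?(ltW w0)//.
  apply: (le_trans trS2); rewrite ler_wpM2l// lef_pV2 ?posrE// -sE expr2 ler_peMr// ltW//.
- rewrite ler_wpM2l ?(ltW c10)//.
  have := Ex_norm_bil2 false false; have := Ex_norm_bil2 true true.
  have := Ex_norm_bil2 false true; lra.
- by rewrite ler_wpM2l// Ex_norm_cross.
Qed.

Definition stat_rate : R :=
  2 * (K / w + 2 * (K ^+ 4 + 1) / (p * w) + K ^+ 2 / (v * Num.sqrt w)) +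
  stein_bound * ((K + K ^+ 2 + 1) / v + 8 * `|kappa| * K ^+ 2).

(** The bound is the same for all admissible [h], however steep. *)
Lemma smoothed_kolmogorov : `|Ex (fun c => h (stat c)) - gaussmean h| <=
  stat_rate * (1 + `|z|) / s.
Proof.
have th : tame (fun c => h (stat c)).
  apply: (@tame_comp _ _ h 1) => //; first exact: continuous_measurable_fun.
  move=> x; rewrite mul1r; have := h01 x; have : 0 <= `|x| by [].
  by rewrite ler_norml; lra.
have -> : Ex (fun c => h (stat c)) - gaussmean h = Ex (fun c => h (stat c) - gaussmean h).
  by rewrite (ExB r1 gaussian) ?Ex_cst//; tame_tac.
apply: (le_trans norm_Ex_stein); rewrite ler_pdivlMr//.
have si : 0 <= s^-1 by rewrite invr_ge0 ltW.
have e1 : Ex (fun c => `|1 - tau * Gam c|) * s <=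
   K / w + 2 * (K ^+ 4 + 1) / (p * w) + `|z| * (K ^+ 2 / (v * Num.sqrt w)).
  by rewrite -ler_pdivlMr// Ex_norm_Gam.
have e2 : Ex (fun c => `|eps c|) * s <=
   `|z| * ((K + K ^+ 2 + 1) / v) + 8 * `|kappa| * K ^+ 2.
  by rewrite -ler_pdivlMr// Ex_norm_eps.
have z0 : 0 <= `|z| by [].
have [w0' v0' p0'] := And3 (ltW w0) (ltW v0) (ltW p0).
have Kn k : 0 <= K ^+ k by exact: exprn_ge0.
have K1 : 0 <= K / w + 2 * (K ^+ 4 + 1) / (p * w).
  by apply: addr_ge0; apply: divr_ge0 => //; apply: mulr_ge0 => //; exact: addr_ge0.
have K2 : 0 <= K ^+ 2 / (v * Num.sqrt w).
  by apply: divr_ge0 => //; exact: mulr_ge0.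
have K3 : 0 <= (K + K ^+ 2 + 1) / v.
  by apply: divr_ge0 => //; apply: addr_ge0 => //; exact: addr_ge0.
have K4 : 0 <= 8 * `|kappa| * K ^+ 2 by rewrite !mulr_ge0 ?exprn_ge0.
rewrite /stat_rate.
set A := _ + _ / _ in e1 K1 *; set B := _ / (v * _) in e1 K2 *.
set C := _ / v in e2 K3 *; set D := 8 * _ * _ in e2 K4 *.
have e2' := ler_wpM2l sb0 e2.
have m1 : 0 <= A * `|z| by rewrite mulr_ge0.
have m2 : 0 <= stein_bound * C by rewrite mulr_ge0.
have m3 : 0 <= stein_bound * (D * `|z|) by rewrite !mulr_ge0.
have -> : (2 * (A + B) + stein_bound * (C + D)) * (1 + `|z|) =
   2 * (A + `|z| * B) + stein_bound * (`|z| * C + D) +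
   (2 * B + 2 * (A * `|z|) + stein_bound * C + stein_bound * (D * `|z|)) by ring.
have -> : (2 * Ex (fun c => `|1 - tau * Gam c|) + stein_bound * Ex (fun c => `|eps c|)) * s =
  2 * (Ex (fun c => `|1 - tau * Gam c|) * s) + stein_bound * (Ex (fun c => `|eps c|) * s) by ring.
lra.
Qed.

End bound.

(** * Indicators and ramps *)

Section ramp.
Context {R : realType}.

(** The truncation of [y] to [0, 1], in terms of absolute values, which makes continuity
    immediate. *)
Definition clip (y : R) : R := (`|y| - `|y - 1| + 1) / 2.

Lemma clip01 y : 0 <= clip y <= 1.
Proof.
rewrite /clip; case: (ger0P y) => h; case: (ger0P (y - 1)) => k; apply/andP; split; lra.
Qed.

Lemma clip_eq1 y : 1 <= y -> clip y = 1.
Proof. by rewrite /clip => h; rewrite !ger0_norm; [field|lra|lra]. Qed.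

Lemma clip_eq0 y : y <= 0 -> clip y = 0.
Proof. by rewrite /clip => h; rewrite !ler0_norm; [field|lra|lra]. Qed.

Lemma continuous_clip : continuous clip.
Proof.
move=> y; apply: cvgM; last exact: cvg_cst.
apply: cvgD; last exact: cvg_cst.
apply: cvgB; first by apply: cvg_norm; exact: cvg_id.
by apply: cvg_norm; apply: cvgB; [exact: cvg_id|exact: cvg_cst].
Qed.

Definition ramp (z e x : R) : R := clip ((z + e - x) / e).

Lemma ramp01 z e x : 0 <= ramp z e x <= 1. Proof. exact: clip01. Qed.

Lemma continuous_ramp z e : continuous (ramp z e).
Proof.
move=> x; apply: (@continuous_comp _ _ _ (fun x => (z + e - x) / e) clip).
  apply: cvgM; last exact: cvg_cst.
  by apply: cvgB; [exact: cvg_cst|exact: cvg_id].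
exact: continuous_clip.
Qed.

Lemma ramp_eq1 z e x : 0 < e -> x <= z -> ramp z e x = 1.
Proof. by move=> e0 xz; apply: clip_eq1; rewrite ler_pdivlMr// mul1r; lra. Qed.

Lemma ramp_eq0 z e x : 0 < e -> z + e <= x -> ramp z e x = 0.
Proof. by move=> e0 zx; apply: clip_eq0; rewrite ler_pdivrMr// mul0r; lra. Qed.

Lemma gausscdf_mkcond (x : R) :
  gausscdf x = \int[lebesgue_measure]_t (gaussd t * \1_`]-oo, x] t).
Proof.
rewrite /gausscdf Rintegral_mkcond; apply: eq_Rintegral => t _.
by rewrite patchE indicE; case: (t \in _); rewrite ?mulr1 ?mulr0.
Qed.

Let mcdf (x : R) : lebesgue_measure.-integrable setT
  (EFin \o (fun t => gaussd t * \1_`]-oo, x] t)).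
Proof.
apply: (le_integrable measurableT _ _ (@integrable_gaussd R)).
  apply/measurable_EFinP; apply: measurable_funM; first exact: measurable_normal_pdf.
  exact: measurable_indic.
move=> t _ /=; rewrite lee_fin normrM ler_piMr// indicE.
by case: (t \in _); rewrite ?normr1 ?normr0.
Qed.

Lemma gausscdf_le (x y : R) : x <= y -> gausscdf x <= gausscdf y.
Proof.
move=> xy; rewrite !gausscdf_mkcond; apply: le_Rintegral => // t _.
rewrite ler_wpM2l ?(ltW (gaussd_gt0 _))// !indicE ler_nat.
case: (boolP (t \in _)) => // /set_mem; rewrite /= in_itv/= => tx.
by rewrite mem_set//= in_itv/= (le_trans tx).
Qed.

Let mramp z e : lebesgue_measure.-integrable setT
  (EFin \o (fun t : R => ramp z e t * gaussd t)).
Proof.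
apply: (le_integrable measurableT _ _ (@integrable_gaussd R)).
  apply/measurable_EFinP; apply: measurable_funM; last exact: measurable_normal_pdf.
  exact: continuous_measurable_fun (@continuous_ramp z e).
move=> t _ /=; rewrite lee_fin normrM ler_piMl//.
by have /andP[h k] := ramp01 z e t; rewrite ger0_norm.
Qed.

Lemma gaussmean_ramp_le z e : 0 < e -> gaussmean (ramp z e) <= gausscdf z + e.
Proof.
move=> e0; apply: le_trans (gausscdf_lipschitz z (ltW e0)).
rewrite gausscdf_mkcond; apply: le_Rintegral => // t _.
rewrite [leRHS]mulrC ler_wpM2r ?(ltW (gaussd_gt0 _))// indicE.
case: (leP t (z + e)) => h.
  by rewrite mem_set ?in_itv//=; have /andP[] := ramp01 z e t.
rewrite memNset; last by rewrite /= in_itv/= leNgt h.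
by rewrite ramp_eq0// ltW.
Qed.

Lemma gaussmean_ramp_ge z e : 0 < e -> gausscdf z <= gaussmean (ramp z e).
Proof.
move=> e0; rewrite gausscdf_mkcond; apply: le_Rintegral => // t _.
rewrite [leLHS]mulrC ler_wpM2r ?(ltW (gaussd_gt0 _))// indicE.
case: (leP t z) => h.
  by rewrite mem_set ?in_itv//= ramp_eq1.
rewrite memNset; last by rewrite /= in_itv/= leNgt h.
by have /andP[] := ramp01 z e t.
Qed.

End ramp.

(** * Probabilities bounded by expectations of tame functionals *)

Section probability_bounds.
Context d (T : measurableType d) {R : realType} (P : probability T R).
Variables (r : R) (n : nat) (Z : 'I_n -> {mfun T >-> (R * R)%type}).
Hypothesis r1 : `|r| < 1.
Hypothesis gaussian : forall i, centered_gaussian2 (corr_mx r) (distribution P (Z i)).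
Local Notation Ex := (Ex P Z).

Let probE (A : set T) : measurable A -> fine (P A) = \int[P]_w \1_A w.
Proof. by move=> mA; rewrite /Rintegral integral_indic// setIT. Qed.

Let iindic (A : set T) : measurable A -> P.-integrable setT (EFin \o \1_A).
Proof. exact: integrable_indic. Qed.

Lemma prob_le_Ex (A : set T) phi : measurable A -> tame phi ->
  (forall c, 0 <= phi c) -> (forall w, A w -> 1 <= phi (sample Z w)) ->
  fine (P A) <= Ex phi.
Proof.
move=> mA tphi phi0 Aphi; rewrite probE//; apply: le_Rintegral => //.
- exact: (iindic mA).
- exact: (integrable_tame r1 gaussian tphi).
move=> w _; rewrite indicE; case: (boolP (w \in A)) => [/set_mem|_]; last exact: phi0.
exact: Aphi.
Qed.

Lemma Ex_le_prob (A : set T) phi : measurable A -> tame phi ->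
  (forall c, phi c <= 1) -> (forall w, ~ A w -> phi (sample Z w) <= 0) ->
  Ex phi <= fine (P A).
Proof.
move=> mA tphi phi1 Aphi; rewrite probE//; apply: le_Rintegral => //.
- exact: (integrable_tame r1 gaussian tphi).
- exact: (iindic mA).
move=> w _; rewrite indicE; case: (boolP (w \in A)) => [_|/negP wA]; first exact: phi1.
by apply: Aphi => Aw; apply: wA; exact: mem_set.
Qed.

End probability_bounds.

(** * The covariance matrix of the autoregression *)

Section ar1_matrix.
Context {R : realFieldType}.
Variable alpha : R.
Hypothesis halpha : `|alpha| < 1.

(** Truncated subtraction covers [N <= k] too: the sum is then 0 and the power is 1. *)
Lemma geo_col (x : R) (k N : nat) :
  (1 - x) * (\sum_(i < N) (if (k <= i)%N then x ^+ (i - k) else 0)) = 1 - x ^+ (N - k).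
Proof.
elim: N => [|N IH]; first by rewrite big_ord0 mulr0 sub0n subrr.
rewrite big_ord_recr /= mulrDr IH; case: leqP => kN.
  by rewrite subSn// exprS; ring.
by rewrite mulr0 addr0 (eqP (ltnW kN)) (eqP kN).
Qed.

Lemma geo_row (x : R) (i N : nat) :
  (1 - x) * (\sum_(l < N) (if (l <= i)%N then x ^+ (i - l) else 0)) =
  x ^+ (i.+1 - N) - x ^+ i.+1.
Proof.
elim: N => [|N IH]; first by rewrite big_ord0 mulr0 subn0 subrr.
rewrite big_ord_recr /= mulrDr IH subSS; case: leqP => Ni.
  by rewrite subSn// exprS; ring.
have /eqP -> : (i.+1 - N == 0)%N by rewrite subn_eq0.
have /eqP -> : (i - N == 0)%N by rewrite subn_eq0 ltnW.
by rewrite mulr0 addr0.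
Qed.

(** Indices start at 0: this is the coefficient of the innovation [k.+1] in the value [i.+1] of the
    process. *)
Definition ar1_coef (i k : nat) : R := if (k <= i)%N then alpha ^+ (i - k) else 0.

Let a : R := `|alpha|.
Let b := alpha ^+ 2.
(** A common bound for the absolute row and column sums of the coefficient matrix, independent of
    its size. *)
Let q : R := (1 - a)^-1.

Let a0 : 0 <= a. Proof. exact: normr_ge0. Qed.
Let a1 : 0 < 1 - a. Proof. by rewrite subr_gt0. Qed.
Let q1 : 1 <= q. Proof. by rewrite /q invf_ge1// gerBl. Qed.
Let q0 : 0 <= q. Proof. exact: le_trans ler01 q1. Qed.
Let bE : b = a ^+ 2. Proof. by rewrite /a real_normK ?num_real. Qed.
Let b0 : 0 <= b. Proof. exact: sqr_ge0. Qed.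
Let b1 : 0 < 1 - b. Proof. by rewrite bE subr_gt0 expr_lt1. Qed.
Let pb : 1 - b != 0. Proof. by rewrite gt_eqF. Qed.
Let qb : (1 - b)^-1 <= q.
Proof.
rewrite /q lef_pV2 ?posrE// lerD2l lerN2 bE expr2.
by rewrite ler_piMl// ltW.
Qed.
Let qb0 : 0 <= (1 - b)^-1. Proof. by rewrite invr_ge0 ltW. Qed.

Lemma sum_norm_ar1_coef_row i N : \sum_(l < N) `|ar1_coef i l| <= q.
Proof.
rewrite (eq_bigr (fun l : 'I_N => if (l <= i)%N then a ^+ (i - l) else 0)); last first.
  by move=> l _; rewrite /ar1_coef; case: leqP; rewrite ?normrX ?normr0.
rewrite -[leRHS]mulr1 /q ler_pdivlMl// geo_row.
have h : a ^+ (i.+1 - N) <= 1 by rewrite exprn_ile1// ltW.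
by rewrite lerBlDr (le_trans h)// lerDl exprn_ge0.
Qed.

Lemma sum_norm_ar1_coef_col k N : \sum_(i < N) `|ar1_coef i k| <= q.
Proof.
rewrite (eq_bigr (fun i : 'I_N => if (k <= i)%N then a ^+ (i - k) else 0)); last first.
  by move=> l _; rewrite /ar1_coef; case: leqP; rewrite ?normrX ?normr0.
by rewrite -[leRHS]mulr1 /q ler_pdivlMl// geo_col gerBl exprn_ge0.
Qed.

Variable n : nat.
Hypothesis n0 : (0 < n)%N.
Let nR : 0 < n%:R :> R. Proof. by rewrite ltr0n. Qed.
Let nu : n%:R != 0 :> R. Proof. by rewrite gt_eqF. Qed.

Definition gram (k l : 'I_n) : R := \sum_(i < n) ar1_coef i k * ar1_coef i l.
Definition colsum (k : 'I_n) : R := \sum_(i < n) ar1_coef i k.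
(** With A the matrix of [ar1_coef] and J the all-ones matrix, this is A^T (I - J / n) A / n; the
    term in J comes from subtracting the empirical means. *)
Definition cov_mx (k l : 'I_n) : R :=
  n%:R^-1 * gram k l - (n%:R ^+ 2)^-1 * (colsum k * colsum l).

Lemma cov_mxC k l : cov_mx k l = cov_mx l k.
Proof.
rewrite /cov_mx (mulrC (colsum k)) /gram.
by congr (_ * _ - _); apply: eq_bigr => i _; rewrite mulrC.
Qed.

Let sum_gram k : \sum_(l < n) `|gram k l| <= q ^+ 2.
Proof.
apply: (@le_trans _ _ (\sum_(l < n) \sum_(i < n) `|ar1_coef i k| * `|ar1_coef i l|)).
  apply: ler_sum => l _; rewrite (le_trans (ler_norm_sum _ _ _))//.
  by apply: ler_sum => i _; rewrite normrM.
rewrite exchange_big/= expr2.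
under eq_bigr do rewrite -mulr_sumr.
apply: (@le_trans _ _ (\sum_(i < n) `|ar1_coef i k| * q)).
  by apply: ler_sum => i _; rewrite ler_wpM2l// sum_norm_ar1_coef_row.
by rewrite -mulr_suml ler_wpM2r// sum_norm_ar1_coef_col.
Qed.

Let colsum_le k : `|colsum k| <= q.
Proof. exact: (le_trans (ler_norm_sum _ _ _) (sum_norm_ar1_coef_col _ _)). Qed.

Let sum_cst (c : R) : \sum_(k < n) c = n%:R * c.
Proof. by rewrite sumr_const card_ord mulr_natl. Qed.

Lemma sum_cov_mx k : \sum_(l < n) `|cov_mx k l| <= 2 * q ^+ 2 / n%:R.
Proof.
apply: (@le_trans _ _ (\sum_(l < n) (n%:R^-1 * `|gram k l| + (n%:R ^+ 2)^-1 * (q * q)))).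
  apply: ler_sum => l _; rewrite /cov_mx (le_trans (ler_normB _ _))//.
  rewrite !normrM !normfV normrX (gtr0_norm nR) lerD2l.
  rewrite ler_wpM2l ?invr_ge0 ?exprn_ge0 ?(ltW nR)//.
  by apply: ler_pM => //; exact: colsum_le.
rewrite big_split/= -mulr_sumr sum_cst.
have -> : n%:R * ((n%:R ^+ 2)^-1 * (q * q)) = n%:R^-1 * q ^+ 2 by field.
rewrite -mulrDr mulrC ler_pdivrMr// divfK//.
by have := sum_gram k; lra.
Qed.

Definition tr_cov : R := \sum_(k < n) cov_mx k k.
Definition tr_cov2 : R := \sum_(k < n) \sum_(l < n) cov_mx k l ^+ 2.

(** The trace of A^T A is the sum of the variances (1 - b^(i+1)) / (1 - b) of the process. The
    geometric deficits and the centring term each cost at most q^2 / n after normalization. *)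
Lemma tr_cov_le : `|tr_cov - (1 - alpha ^+ 2)^-1| <= 2 * q ^+ 2 / n%:R.
Proof.
rewrite -/b /tr_cov /cov_mx sumrB -!mulr_sumr.
have -> : \sum_(k < n) gram k k = \sum_(i < n) (1 - b ^+ i.+1) / (1 - b).
  rewrite /gram exchange_big/=; apply: eq_bigr => i _.
  rewrite (eq_bigr (fun l : 'I_n => if (l <= i)%N then b ^+ (i - l) else 0)); last first.
    by move=> l _; rewrite /ar1_coef; case: leqP => _; rewrite ?mulr0// -expr2 -exprM mulnC exprM.
  apply/eqP; rewrite eq_sym -(inj_eq (mulfI pb)) geo_row.
  have /eqP -> : (i.+1 - n == 0)%N by rewrite subn_eq0.
  by apply/eqP; rewrite mulrC divfK.
have -> : n%:R^-1 * (\sum_(i < n) (1 - b ^+ i.+1) / (1 - b)) =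
    (1 - b)^-1 - n%:R^-1 * ((\sum_(i < n) b ^+ i.+1) / (1 - b)).
  rewrite -!mulr_suml sumrB sum_cst; field.
  by rewrite pb nu.
rewrite addrAC [X in `|X - _|]addrAC subrr add0r -opprD normrN.
rewrite (le_trans (ler_normD _ _))//.
have h1 : 0 <= \sum_(i < n) b ^+ i.+1 <= q.
  rewrite sumr_ge0//=; last by move=> i _; rewrite exprn_ge0.
  apply: (@le_trans _ _ (\sum_(i < n) `|ar1_coef i 0|)); last exact: sum_norm_ar1_coef_col.
  apply: ler_sum => i _; rewrite /ar1_coef leq0n subn0 normrX -/a bE -exprM.
  apply: ler_wiXn2l => //; first exact: ltW.
  by rewrite mul2n -addnn (leq_trans (leqnSn _) (leq_addr _ _)).
have {h1} : `|n%:R^-1 * ((\sum_(i < n) b ^+ i.+1) / (1 - b))| <= n%:R^-1 * q ^+ 2.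
  case/andP: h1 => h1 h2.
  rewrite ger0_norm; last by rewrite mulr_ge0 ?invr_ge0 ?(ltW nR)// mulr_ge0.
  by rewrite ler_wpM2l ?invr_ge0 ?(ltW nR)// expr2; apply: ler_pM.
have : `|(n%:R ^+ 2)^-1 * (\sum_(i < n) colsum i * colsum i)| <= n%:R^-1 * q ^+ 2.
  rewrite normrM normfV normrX (gtr0_norm nR).
  have -> : n%:R^-1 * q ^+ 2 = (n%:R ^+ 2)^-1 * (n%:R * q ^+ 2) by field.
  rewrite ler_wpM2l ?invr_ge0 ?exprn_ge0 ?(ltW nR)// -sum_cst.
  rewrite (le_trans (ler_norm_sum _ _ _))// ler_sum// => k _.
  by rewrite normrM expr2 ler_pM// colsum_le.
rewrite -mulrA [_ / _]mulrC; lra.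
Qed.

Let gram' (i j : 'I_n) : R := \sum_(k < n) ar1_coef i k * ar1_coef j k.

(** tr ((A^T A)^2) = tr ((A A^T)^2): both expand into the same fourfold sum. The right-hand matrix
    holds the covariances of the process. *)
Let sum_gram2 : \sum_(k < n) \sum_(l < n) gram k l ^+ 2 = \sum_(i < n) \sum_(j < n) gram' i j ^+ 2.
Proof.
have gE k l : gram k l ^+ 2 = \sum_(i < n) \sum_(j < n)
   ar1_coef i k * ar1_coef i l * (ar1_coef j k * ar1_coef j l).
  by rewrite expr2 /gram mulr_suml; apply: eq_bigr => i _; rewrite mulr_sumr.
have gE' i j : gram' i j ^+ 2 = \sum_(k < n) \sum_(l < n)
   ar1_coef i k * ar1_coef i l * (ar1_coef j k * ar1_coef j l).
  rewrite expr2 /gram' mulr_suml; apply: eq_bigr => k _; rewrite mulr_sumr.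
  by apply: eq_bigr => l _; ring.
under eq_bigr do under eq_bigr do rewrite gE.
under [RHS]eq_bigr do under eq_bigr do rewrite gE'.
under eq_bigr do rewrite exchange_big/=.
rewrite exchange_big/=; apply: eq_bigr => i _.
under eq_bigr do rewrite exchange_big/=.
by rewrite exchange_big.
Qed.

Let gram'C i j : gram' i j = gram' j i.
Proof. by apply: eq_bigr => k _; rewrite mulrC. Qed.

Let gram'E (i j : 'I_n) : (j <= i)%N ->
  gram' i j = alpha ^+ (i - j) * ((1 - b ^+ j.+1) / (1 - b)).
Proof.
move=> ji; rewrite /gram'.
rewrite (eq_bigr (fun k : 'I_n => alpha ^+ (i - j) * (if (k <= j)%N then b ^+ (j - k) else 0))).
  rewrite -mulr_sumr; congr (_ * _); apply: (mulfI pb); rewrite geo_row.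
  have /eqP -> : (j.+1 - n == 0)%N by rewrite subn_eq0.
  by rewrite mulrC divfK.
move=> k _; rewrite /ar1_coef; case: (leqP k j) => kj; last by rewrite !mulr0.
rewrite (leq_trans kj ji) /b -exprM -!exprD; congr (_ ^+ _).
have -> : (i - k = i - j + (j - k))%N by rewrite addnBA// subnK.
by rewrite mul2n -addnn addnA.
Qed.

Let dist (i j : nat) : nat := (maxn i j - minn i j)%N.

(** The comparison is with the squared stationary covariances. The bound factorizes in [i] and [j],
    so its double sum stays bounded as [n] grows. *)
Let gram'2 (i j : 'I_n) :
  `|gram' i j ^+ 2 - b ^+ dist i j / (1 - b) ^+ 2| <= 2 * q ^+ 2 * (a ^+ i * a ^+ j).
Proof.
wlog ji : i j / (j <= i)%N.
  move=> h; case: (leqP j i) => [|/ltnW] ji; first exact: h.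
  by rewrite gram'C /dist maxnC minnC (mulrC (a ^+ i)); exact: h.
rewrite gram'E// /dist (maxn_idPl ji) (minn_idPr ji) exprMn -exprM mulnC exprM -/b.
have -> : b ^+ (i - j) * ((1 - b ^+ j.+1) / (1 - b)) ^+ 2 - b ^+ (i - j) / (1 - b) ^+ 2 =
  - (b ^+ (i - j) * b ^+ j.+1 * (2 - b ^+ j.+1) * ((1 - b)^-1 ^+ 2)).
  by field.
have bj0 : 0 <= b ^+ j.+1 <= 1 by rewrite exprn_ge0//= exprn_ile1// -subr_ge0 ltW.
have h1 : 0 <= 2 - b ^+ j.+1 <= 2 by lra.
have h2 : 0 <= b ^+ (i - j) * b ^+ j.+1 <= a ^+ i * a ^+ j.
  apply/andP; split; first by apply: mulr_ge0; exact: exprn_ge0.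
  rewrite -exprD -(exprD a) bE -exprM.
  apply: ler_wiXn2l => //; first exact: ltW.
  by rewrite addnS subnK// mul2n -addnn leq_add// ?leqW.
have h3 : 0 <= (1 - b)^-1 ^+ 2 <= q ^+ 2.
  by rewrite exprn_ge0//= lerXn2r ?nnegrE.
case/andP: h1 => h1 h1'; case/andP: h2 => h2 h2'; case/andP: h3 => h3 h3'.
rewrite normrN ger0_norm; last by apply: mulr_ge0 => //; apply: mulr_ge0.
rewrite [leRHS](_ : _ = a ^+ i * a ^+ j * 2 * q ^+ 2); last by ring.
by apply: ler_pM => //; [exact: mulr_ge0|apply: ler_pM].
Qed.

(** Going from N to N + 1 adjoins a row and a column, both geometric sums, and one diagonal
    entry. *)
Let sum_dist N : (\sum_(i < N) \sum_(j < N) b ^+ dist i j) * (1 - b) ^+ 2 =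
  N%:R * (1 + b) * (1 - b) - 2 * b * (1 - b ^+ N).
Proof.
elim: N => [|N IH]; first by rewrite big_ord0 expr0; ring.
have hN : (1 - b) * (\sum_(i < N) b ^+ (N - i)) = b - b ^+ N.+1.
  have := geo_row b N N; rewrite subSnn expr1 => <-; congr (_ * _).
  by apply: eq_bigr => i _; rewrite ltnW.
rewrite big_ord_recr/= big_ord_recr/=.
under eq_bigr do rewrite big_ord_recr/=.
rewrite big_split/= /dist maxnn minnn subnn expr0.
have -> : \sum_(i < N) b ^+ (maxn i N - minn i N) = \sum_(i < N) b ^+ (N - i).
  by apply: eq_bigr => i _; rewrite (maxn_idPr (ltnW (ltn_ord i))) (minn_idPl (ltnW (ltn_ord i))).
have -> : \sum_(i < N) b ^+ (maxn N i - minn N i) = \sum_(i < N) b ^+ (N - i).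
  by apply: eq_bigr => i _; rewrite (maxn_idPl (ltnW (ltn_ord i))) (minn_idPr (ltnW (ltn_ord i))).
move: IH; rewrite /dist; set Q := \sum_(_ < N) _; set G := \sum_(_ < N) _ in hN *.
rewrite -natr1 exprS in hN * => IH.
have -> : (Q + G + (G + 1)) * (1 - b) ^+ 2 =
  Q * (1 - b) ^+ 2 + 2 * (1 - b) * ((1 - b) * G) + (1 - b) ^+ 2 by ring.
rewrite IH hN; ring.
Qed.

(** The constant 7 is 2 + 2 + 3: the boundary term of [sum_dist], the distance [E] to the stationary
    covariances and the effect [D] of the centring. *)
Lemma tr_cov2_le : `|n%:R * tr_cov2 - (1 + alpha ^+ 2) / (1 - alpha ^+ 2) ^+ 3|
  <= 7 * q ^+ 4 / n%:R.
Proof.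
have sum_a : \sum_(i < n) a ^+ i <= q.
  apply: le_trans (sum_norm_ar1_coef_col 0 n); apply: ler_sum => i _.
  by rewrite /ar1_coef leq0n subn0 normrX.
have sum_a0 : 0 <= \sum_(i < n) a ^+ i by rewrite sumr_ge0// => i _; rewrite exprn_ge0.
pose E := \sum_(i < n) \sum_(j < n) (gram' i j ^+ 2 - b ^+ dist i j / (1 - b) ^+ 2).
have hE : `|E| <= 2 * q ^+ 4.
  apply: (@le_trans _ _ (\sum_(i < n) \sum_(j < n) 2 * q ^+ 2 * (a ^+ i * a ^+ j))).
    rewrite (le_trans (ler_norm_sum _ _ _))// ler_sum// => i _.
    by rewrite (le_trans (ler_norm_sum _ _ _))// ler_sum.
  under eq_bigr do rewrite -mulr_sumr -mulr_sumr.
  rewrite -mulr_sumr -mulr_suml.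
  rewrite [leRHS](_ : _ = 2 * q ^+ 2 * (q * q)); last by ring.
  by rewrite ler_wpM2l ?mulr_ge0 ?exprn_ge0//; apply: ler_pM.
pose D := \sum_(k < n) \sum_(l < n) (cov_mx k l ^+ 2 - (n%:R^-1 * gram k l) ^+ 2).
have ni : 0 <= n%:R^-1 :> R by rewrite invr_ge0 ltW.
have hD : `|D| <= 3 * q ^+ 4 * (n%:R^-1) ^+ 2.
  apply: (@le_trans _ _ (\sum_(k < n) \sum_(l < n) (n%:R^-1 ^+ 2 * q ^+ 2) *
     (n%:R^-1 ^+ 2 * q ^+ 2 + 2 * n%:R^-1 * `|gram k l|))).
    rewrite (le_trans (ler_norm_sum _ _ _))// ler_sum// => k _.
    rewrite (le_trans (ler_norm_sum _ _ _))// ler_sum// => l _.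
    rewrite /cov_mx -exprVn; set B := _ * (colsum k * colsum l).
    have hB : `|B| <= n%:R^-1 ^+ 2 * q ^+ 2.
      rewrite /B normrM (ger0_norm (exprn_ge0 _ ni)) ler_wpM2l ?exprn_ge0//.
      by rewrite normrM expr2; apply: ler_pM => //; exact: colsum_le.
    have -> : (n%:R^-1 * gram k l - B) ^+ 2 - (n%:R^-1 * gram k l) ^+ 2 =
       B * (B - 2 * n%:R^-1 * gram k l) by ring.
    rewrite normrM; apply: ler_pM => //.
    rewrite (le_trans (ler_normB _ _))// lerD// normrM.
    by rewrite (ger0_norm (mulr_ge0 _ ni)).
  under eq_bigr do rewrite -mulr_sumr.
  rewrite -mulr_sumr.
  rewrite [leRHS](_ : _ = n%:R^-1 ^+ 2 * q ^+ 2 * (3 * q ^+ 2)); last by ring.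
  rewrite ler_wpM2l ?mulr_ge0 ?exprn_ge0//.
  apply: (@le_trans _ _ (\sum_(k < n) (n%:R^-1 * (3 * q ^+ 2)))).
    apply: ler_sum => k _; rewrite big_split/= sum_cst -mulr_sumr.
    have -> : n%:R * (n%:R^-1 ^+ 2 * q ^+ 2) = n%:R^-1 * q ^+ 2 by field.
    rewrite (mulrC 2) -mulrA -mulrDr ler_wpM2l//.
    by have := sum_gram k; lra.
  by rewrite sum_cst mulrA divff// mul1r.
have sd := sum_dist n.
have -> : n%:R * tr_cov2 = (1 + b) / (1 - b) ^+ 3
    - n%:R^-1 * (2 * b * (1 - b ^+ n) * (1 - b)^-1 ^+ 4) + n%:R^-1 * E + n%:R * D.
  have -> : tr_cov2 = n%:R^-1 ^+ 2 * \sum_(k < n) \sum_(l < n) gram k l ^+ 2 + D.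
    rewrite /tr_cov2 mulr_sumr /D -big_split/=; apply: eq_bigr => k _.
    rewrite mulr_sumr -big_split/=; apply: eq_bigr => l _.
    by rewrite exprMn addrC subrK.
  have -> : \sum_(k < n) \sum_(l < n) gram k l ^+ 2 =
      (\sum_(i < n) \sum_(j < n) b ^+ dist i j) * (1 - b)^-1 ^+ 2 + E.
    rewrite sum_gram2 mulr_suml /E -big_split/=; apply: eq_bigr => i _.
    rewrite mulr_suml -big_split/=; apply: eq_bigr => j _.
    by rewrite exprVn addrC subrK.
  have -> : \sum_(i < n) \sum_(j < n) b ^+ dist i j =
      (n%:R * (1 + b) * (1 - b) - 2 * b * (1 - b ^+ n)) / (1 - b) ^+ 2.
    by rewrite -sd mulfK// expf_neq0.
  by field; rewrite pb nu.
rewrite -/b.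
set X := n%:R^-1 * (2 * _ * _ * _).
have hX : `|X| <= n%:R^-1 * (2 * q ^+ 4).
  have bn : 0 <= 1 - b ^+ n <= 1.
    have hb : b ^+ n <= 1 by apply: exprn_ile1 => //; rewrite -subr_ge0 ltW.
    by rewrite subr_ge0 hb gerBl exprn_ge0.
  case/andP: bn => bn0 bn1; have bl1 : b <= 1 by rewrite -subr_ge0 ltW.
  have q4 : 0 <= (1 - b)^-1 ^+ 4 <= q ^+ 4.
    by rewrite exprn_ge0//= lerXn2r ?nnegrE.
  case/andP: q4 => q40 q41.
  have bb : 0 <= b * (1 - b ^+ n) by exact: mulr_ge0.
  rewrite /X -(mulrA 2) -(mulrA 2) ger0_norm; last by do 3 apply: mulr_ge0 => //.
  rewrite ler_wpM2l// ler_wpM2l// -[leRHS]mul1r.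
  by apply: ler_pM => //; apply: mulr_ile1.
have hE' : `|n%:R^-1 * E| <= n%:R^-1 * (2 * q ^+ 4).
  by rewrite normrM (ger0_norm ni) ler_wpM2l.
have hD' : `|n%:R * D| <= n%:R^-1 * (3 * q ^+ 4).
  rewrite normrM (gtr0_norm nR).
  rewrite [leRHS](_ : _ = n%:R * (3 * q ^+ 4 * n%:R^-1 ^+ 2)); last by field.
  by rewrite ler_wpM2l// ltW.
rewrite [X in `|X|](_ : _ = - X + n%:R^-1 * E + n%:R * D); last by ring.
rewrite (le_trans (ler_normD _ _))// (le_trans (lerD (ler_normD _ _) (lexx _)))//.
by rewrite normrN [leRHS]mulrC; lra.
Qed.

End ar1_matrix.

(** * The empirical correlation as a function of quadratic forms *)

(** For the arithmetic mean m and the geometric mean g, (A - B)^2 = 4 (m - g)(m + g), and 2 (m + g)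
    >= v by the lower bounds on [A] and [B]. Hence (m - g) v <= (A - B)^2 / 2, and |c| <= 2 turns
    this into an error of at most (A - B)^2 / v. *)
Lemma corr_sandwich (R : realType) (v A B D c : R) : 0 < v -> v / 2 <= A -> v / 2 <= B ->
  `|c| <= 2 ->
  (D / Num.sqrt (A * B) <= c -> D - c * ((A + B) / 2) - (A - B) ^+ 2 / v <= 0) /\
  (D - c * ((A + B) / 2) + (A - B) ^+ 2 / v <= 0 -> D / Num.sqrt (A * B) <= c).
Proof.
move=> v0 hA hB hc.
have A0 : 0 < A by apply: lt_le_trans hA; rewrite divr_gt0.
have B0 : 0 < B by apply: lt_le_trans hB; rewrite divr_gt0.
have AB0 : 0 < A * B by rewrite mulr_gt0.
set g := Num.sqrt (A * B).
have g0 : 0 < g by rewrite sqrtr_gt0.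
have gE : g ^+ 2 = A * B by rewrite sqr_sqrtr// ltW.
have gle : g <= (A + B) / 2.
  rewrite -(@ler_pXn2r _ 2)// ?nnegrE ?(ltW g0)//; last by rewrite divr_ge0// addr_ge0// ltW.
  by rewrite gE; have := sqr_ge0 (A - B); rewrite -subr_ge0 -[X in _ -> 0 <= X](_ : (A - B) ^+ 2 / 4 = _); [move=> h; rewrite divr_ge0|field].
have gap : `|c * g - c * ((A + B) / 2)| <= (A - B) ^+ 2 / v.
  rewrite -mulrBr normrM distrC [`|_ - g|]ger0_norm ?subr_ge0//.
  have h : ((A + B) / 2 - g) * v <= (A - B) ^+ 2 / 2.
    have -> : (A - B) ^+ 2 = 4 * (((A + B) / 2 - g) * ((A + B) / 2 + g)).
      transitivity (4 * (((A + B) / 2) ^+ 2 - g ^+ 2)); last by ring.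
      by rewrite gE; field.
    have k : 0 <= (A + B) / 2 - g by rewrite subr_ge0.
    have : ((A + B) / 2 - g) * v <= ((A + B) / 2 - g) * (2 * ((A + B) / 2 + g)).
      by rewrite ler_wpM2l//; lra.
    by lra.
  rewrite ler_pdivlMr// -mulrA.
  apply: (@le_trans _ _ (2 * (((A + B) / 2 - g) * v))).
    by rewrite ler_wpM2r// mulr_ge0 ?subr_ge0 ?(ltW v0).
  by lra.
rewrite ler_pdivrMr//; move: gap; rewrite ler_norml => /andP[h1 h2].
by split=> h; lra.
Qed.

(** * The Kolmogorov bound at a fixed threshold *)

Section core.
Context d (T : measurableType d) {R : realType} (P : probability T R).
Variables (r : R) (n : nat) (Z : 'I_n -> {mfun T >-> (R * R)%type}).
Hypothesis r1 : `|r| < 1.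
Hypothesis indep : forall A : 'I_n -> set (R * R), (forall i, measurable (A i)) ->
  P (\big[setI/[set: T]]_i (Z i @^-1` A i)) = (\prod_i P (Z i @^-1` A i))%E.
Hypothesis gaussian : forall i, centered_gaussian2 (corr_mx r) (distribution P (Z i)).
Local Notation Ex := (Ex P Z).

Variables (S : 'I_n -> 'I_n -> R) (v w K : R).
Hypotheses (sS : forall i j, S i j = S j i) (n0 : (0 < n)%N) (v0 : 0 < v) (w0 : 0 < w)
  (K0 : 0 <= K).
Hypotheses (rowS : forall i, \sum_j `|S i j| <= K / n%:R)
  (trS : `|mxtr S - v| <= K / n%:R) (trS2 : `|n%:R * mxtr (mxsq S) - w| <= K / n%:R).

Let s : R := Num.sqrt n%:R.
Let p : R := 1 - r ^+ 2.
(** Chosen so that [k0 * s] is tau / v: the correction in [stat] is then [tau] times the one in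
    [corr_sandwich]. *)
Let k0 : R := (v * p * Num.sqrt w)^-1.

Let nR : 0 < n%:R :> R. Proof. by rewrite ltr0n. Qed.
Let s0 : 0 < s. Proof. by rewrite sqrtr_gt0. Qed.
Let sE : s ^+ 2 = n%:R. Proof. by rewrite sqr_sqrtr// ltW. Qed.
Let s1 : 1 <= s. Proof. by rewrite -[leLHS]sqrtr1 ler_wsqrtr// ler1n. Qed.
Let p0 : 0 < p. Proof. by rewrite subr_gt0 -real_normK ?num_real// expr_lt1. Qed.
Let sw0 : 0 < Num.sqrt w. Proof. by rewrite sqrtr_gt0. Qed.

Local Notation q a b := (bil S a b).

Definition quad_corr c := q false true c / Num.sqrt (q false false c * q true true c).
Definition normalized_quad_corr c := v * s / (p * Num.sqrt w) * (quad_corr c - r).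

(** The summands pay for the smoothed comparison, the width of the ramp, the event of a small
    empirical variance and the thresholds [c0] beyond 2 in absolute value. *)
Definition quad_corr_rate : R := stat_rate r v w K k0 + 1 + 4 / v * (K ^+ 2 + 1 + K)
  + p * Num.sqrt w / v.

(** A tame majorant, in the manner of Markov's inequality, of the indicator that one of the
    empirical variances is below v / 2. *)
Let bad c := 2 / v * (`|q false false c - v| + `|q true true c - v|).

Let tbad : tame bad. Proof. by rewrite /bad; tame_tac. Qed.

Let bad0 c : 0 <= bad c.
Proof. by rewrite /bad mulr_ge0 ?divr_ge0 ?(ltW v0)// addr_ge0. Qed.

Let bad1 c : ~~ ((v / 2 <= q false false c) && (v / 2 <= q true true c)) -> 1 <= bad c.
Proof.
have h (x : R) : x < v / 2 -> 1 <= 2 / v * `|x - v|.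
  move=> xv; rewrite mulrAC ler_pdivlMr// mul1r ltr0_norm; first lra.
  by move: v0 xv; lra.
rewrite negb_and -!ltNge /bad mulrDr => /orP[] /h h1; rewrite (le_trans h1)//.
  by rewrite lerDl mulr_ge0 ?divr_ge0 ?(ltW v0).
by rewrite lerDr mulr_ge0 ?divr_ge0 ?(ltW v0).
Qed.

Let Ex_bad : Ex bad <= 4 / v * (K ^+ 2 + 1 + K) / s.
Proof.
have one a : Ex (fun c => `|q a a c - v|) <= (K ^+ 2 + 1 + K) / s.
  apply: (@le_trans _ _ (Ex (fun c => `|q a a c - mxtr S| + `|mxtr S - v|))).
    apply: (le_Ex r1 gaussian); try by tame_tac.
    by move=> c; exact: ler_distD.
  rewrite (ExD r1 gaussian); try by tame_tac.
  rewrite Ex_cst [leRHS]mulrDl; apply: lerD.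
    exact: (Ex_norm_bil r1 indep gaussian sS n0 rowS a).
  apply: (le_trans trS); rewrite ler_wpM2l// lef_pV2 ?posrE// -sE expr2 ler_peMr//.
  exact: ltW.
rewrite /bad (ExZ r1 gaussian _ (phi := fun c => `|q false false c - v| + `|q true true c - v|));
  last by tame_tac.
rewrite (ExD r1 gaussian); try by tame_tac.
rewrite -mulrA.
have -> : 4 / v * ((K ^+ 2 + 1 + K) / s) = 2 / v * (2 * ((K ^+ 2 + 1 + K) / s)) by ring.
rewrite ler_wpM2l ?divr_ge0 ?(ltW v0)//.
by have := one false; have := one true; lra.
Qed.

Variable z : R.
Let c0 := r + z * (p * Num.sqrt w / (v * s)).

Let quad_corr_le c : (normalized_quad_corr c <= z) = (quad_corr c <= c0).
Proof.
rewrite /normalized_quad_corr /c0 -lerBlDl.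
have -> : v * s / (p * Num.sqrt w) * (quad_corr c - r) =
    (quad_corr c - r) / (p * Num.sqrt w / (v * s)).
  by field; rewrite !gt_eqF.
by rewrite ler_pdivrMr// divr_gt0// mulr_gt0.
Qed.

Let statE kappa c : stat r S v w kappa z c - z = s / (p * Num.sqrt w) *
  (q false true c - c0 * ((q false false c + q true true c) / 2)) +
  kappa * s * (q false false c - q true true c) ^+ 2.
Proof.
rewrite /stat /c0 -/s -/p; field.
by rewrite !gt_eqF.
Qed.

Section moderate.
Hypothesis c02 : `|c0| <= 2.

Let tau0 : 0 < s / (p * Num.sqrt w). Proof. by rewrite divr_gt0// mulr_gt0. Qed.

Let upper c : normalized_quad_corr c <= z ->
  1 <= ramp z s^-1 (stat r S v w (- k0) z c) + bad c.
Proof.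
rewrite quad_corr_le => h.
have [/andP[hA hB]|/bad1 b] := boolP ((v / 2 <= q false false c) && (v / 2 <= q true true c)).
  have [/(_ h) {}h _] := corr_sandwich (q false true c) v0 hA hB c02.
  rewrite ramp_eq1 ?invr_gt0 ?lerDl// -subr_le0 statE.
  have -> : - k0 * s * (q false false c - q true true c) ^+ 2 =
    s / (p * Num.sqrt w) * (- ((q false false c - q true true c) ^+ 2 / v)).
    by rewrite /k0; field; rewrite !gt_eqF.
  by rewrite -mulrDr pmulr_rle0.
by rewrite (le_trans b)// lerDr; have /andP[] := ramp01 z s^-1 (stat r S v w (- k0) z c).
Qed.

(** The ramp is moved left by its width, so that it vanishes from [z] on; the opposite sign of
    [kappa] selects the other half of [corr_sandwich]. *)
Let lower c : ~ (normalized_quad_corr c <= z) ->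
  ramp (z - s^-1) s^-1 (stat r S v w k0 z c) - bad c <= 0.
Proof.
move/negP; rewrite quad_corr_le => h.
have [/andP[hA hB]|/bad1 b] := boolP ((v / 2 <= q false false c) && (v / 2 <= q true true c)).
  have [_ k] := corr_sandwich (q false true c) v0 hA hB c02.
  rewrite ramp_eq0 ?invr_gt0 ?sub0r ?oppr_le0// subrK -subr_ge0 statE.
  have -> : k0 * s * (q false false c - q true true c) ^+ 2 =
    s / (p * Num.sqrt w) * ((q false false c - q true true c) ^+ 2 / v).
    by rewrite /k0; field; rewrite !gt_eqF.
  rewrite -mulrDr mulr_ge0 ?(ltW tau0)// leNgt; apply/negP => /ltW /k.
  by rewrite (negbTE h).
rewrite subr_le0 (le_trans _ b)//.
by have /andP[] := ramp01 (z - s^-1) s^-1 (stat r S v w k0 z c).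
Qed.

Let tame_ramp (y e kappa : R) : tame (fun c => ramp y e (stat r S v w kappa z c)).
Proof.
apply: (@tame_comp _ _ (ramp y e) 1).
- exact: continuous_measurable_fun (@continuous_ramp R y e).
- move=> x; rewrite mul1r; have := ramp01 y e x; have : 0 <= `|x| by [].
  by rewrite ler_norml; lra.
- by have [dF [] ] := smooth_stat r w kappa sS v0 z.
Qed.

Lemma quad_corr_kolmogorov_moderate (A : set T) : measurable A ->
  (forall x, A x <-> normalized_quad_corr (sample Z x) <= z) ->
  `|fine (P A) - gausscdf z| <=
    (stat_rate r v w K k0 * (1 + `|z|) + 1 + 4 / v * (K ^+ 2 + 1 + K)) / s.
Proof.
move=> mA AE; have si : 0 < s^-1 by rewrite invr_gt0.
have U : fine (P A) <= Ex (fun c => ramp z s^-1 (stat r S v w (- k0) z c) + bad c).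
  apply: (prob_le_Ex r1 gaussian) => //; first exact: tameD.
    by move=> c; rewrite addr_ge0//; have /andP[] := ramp01 z s^-1 (stat r S v w (- k0) z c).
  by move=> x /AE; exact: upper.
have L : Ex (fun c => ramp (z - s^-1) s^-1 (stat r S v w k0 z c) - bad c) <= fine (P A).
  apply: (Ex_le_prob r1 gaussian) => //; first exact: tameB.
    move=> c; rewrite lerBlDr (@le_trans _ _ 1)// ?lerDl//.
    by have /andP[] := ramp01 (z - s^-1) s^-1 (stat r S v w k0 z c).
  by move=> x Ax; apply: lower => /AE.
rewrite (ExD r1 gaussian)// in U.
rewrite (ExB r1 gaussian)// in L.
have KU := smoothed_kolmogorov r1 indep gaussian (- k0) sS n0 v0 w0 K0 rowS trS trS2 z
  (@continuous_ramp R z s^-1) (@ramp01 R z s^-1).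
have KL := smoothed_kolmogorov r1 indep gaussian k0 sS n0 v0 w0 K0 rowS trS trS2 z
  (@continuous_ramp R (z - s^-1) s^-1) (@ramp01 R (z - s^-1) s^-1).
have rateN : stat_rate r v w K (- k0) = stat_rate r v w K k0 by rewrite /stat_rate normrN.
rewrite rateN in KU.
have GU := gaussmean_ramp_le z si.
have GL := gaussmean_ramp_ge (z - s^-1) si.
have GS : gausscdf z <= gausscdf (z - s^-1) + s^-1.
  by have := gausscdf_lipschitz (z - s^-1) (ltW si); rewrite subrK.
move: KU KL Ex_bad; rewrite !ler_norml => /andP[_ KU] /andP[KL _] EB.
rewrite -/s in KU KL.
rewrite !mulrDl mul1r -addrA -!mulrA in KU KL EB *.
by apply/andP; split; lra.
Qed.

End moderate.

(** When |c0| > 2, the assumption |r| < 1 forces |z| >= v s / (p sqrt w), so the last summand of the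
    rate already makes the bound at least 1. *)
Lemma quad_corr_kolmogorov (A : set T) : measurable A ->
  (forall x, A x <-> normalized_quad_corr (sample Z x) <= z) ->
  `|fine (P A) - gausscdf z| <= quad_corr_rate * (1 + `|z|) / s.
Proof.
move=> mA AE; rewrite ler_pdivlMr//.
have sb0 : 0 <= stein_bound :> R.
  by rewrite /stein_bound addr_ge0// divr_ge0 ?expR_ge0// normal_peak_ge0.
have z0 : 0 <= `|z| by [].
have R0 : 0 <= stat_rate r v w K k0.
  rewrite /stat_rate -/p; have Kn m : 0 <= K ^+ m by exact: exprn_ge0.
  have [v1 w1 p1] := And3 (ltW v0) (ltW w0) (ltW p0).
  have h1 : 0 <= K / w by exact: divr_ge0.
  have h2 : 0 <= 2 * (K ^+ 4 + 1) / (p * w).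
    by apply: divr_ge0; apply: mulr_ge0 => //; exact: addr_ge0.
  have h3 : 0 <= K ^+ 2 / (v * Num.sqrt w) by apply: divr_ge0 => //; exact: mulr_ge0.
  have h4 : 0 <= (K + K ^+ 2 + 1) / v.
    by apply: divr_ge0 => //; apply: addr_ge0 => //; exact: addr_ge0.
  have h5 : 0 <= 8 * `|k0| * K ^+ 2 by apply: mulr_ge0 => //; exact: mulr_ge0.
  by apply: addr_ge0; apply: mulr_ge0 => //; [apply: addr_ge0 => //; exact: addr_ge0|exact: addr_ge0].
have K1 : 0 <= 4 / v * (K ^+ 2 + 1 + K).
  apply: mulr_ge0; first by rewrite divr_ge0// ltW.
  by apply: addr_ge0 => //; apply: addr_ge0 => //; exact: sqr_ge0.
have W0 : 0 <= p * Num.sqrt w / v by rewrite divr_ge0 ?mulr_ge0 ?(ltW p0) ?(ltW v0).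
have m1 : 0 <= 4 / v * (K ^+ 2 + 1 + K) * `|z| by rewrite mulr_ge0.
have m2 : 0 <= p * Num.sqrt w / v * `|z| by rewrite mulr_ge0.
have m3 : 0 <= stat_rate r v w K k0 * `|z| by rewrite mulr_ge0.
have [c02|c02] := leP `|c0| 2.
  have := quad_corr_kolmogorov_moderate c02 mA AE; rewrite ler_pdivlMr// => h; apply: (le_trans h).
  rewrite /quad_corr_rate; lra.
have h1 : s <= p * Num.sqrt w / v * `|z|.
  have : `|c0| <= `|r| + `|z| * (p * Num.sqrt w / (v * s)).
    rewrite (le_trans (ler_normD _ _))// lerD2l normrM ler_wpM2l//.
    by rewrite ger0_norm// divr_ge0 ?mulr_ge0 ?(ltW p0) ?(ltW v0) ?(ltW s0).
  have -> : `|z| * (p * Num.sqrt w / (v * s)) = p * Num.sqrt w / v * `|z| / s.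
    by field; rewrite !gt_eqF.
  move=> h2; have : 1 <= p * Num.sqrt w / v * `|z| / s by move: r1 c02 h2; lra.
  by rewrite ler_pdivlMr// mul1r.
have h2 : `|fine (P A) - gausscdf z| <= 1.
  have := gausscdf_ge0 z; have := gausscdf_le1 z.
  have : 0 <= fine (P A) by rewrite fine_ge0.
  have : fine (P A) <= 1.
    by rewrite -lee_fin fineK ?fin_num_measure// probability_le1.
  by rewrite ler_norml; lra.
apply: (@le_trans _ _ s); first by rewrite -[leRHS]mul1r ler_wpM2r// ltW.
by apply: (le_trans h1); rewrite /quad_corr_rate; lra.
Qed.

End core.

(** * The Kolmogorov bound *)

Section ar1_quadratic.
Context d (T : measurableType d) {R : realType} (P : probability T R).
Variables (alpha : R) (xi eta : nat -> {RV P >-> R}) (n : nat).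

Definition innovations (i : 'I_n) : {mfun T >-> (R * R)%type} :=
  pair_rv (xi i.+1) (eta i.+1).

Definition innovation (b : bool) : nat -> T -> R := if b then eta else xi.

Lemma sampleE w b i : sample innovations w (b, i) = innovation b i.+1 w.
Proof. by rewrite /sample /coords /innovations /innovation /pair_rv /=; case: b. Qed.

Lemma ar1E (u : nat -> T -> R) (m : nat) w :
  ar1 alpha u m w = \sum_(k < m) alpha ^+ (m.-1 - k) * u k.+1 w.
Proof.
elim: m => [|m IH]; first by rewrite big_ord0.
rewrite /= IH big_ord_recr/= subnn expr0 mul1r; congr (_ + _).
rewrite mulr_sumr; apply: eq_bigr => k _; rewrite mulrA -exprS.
congr (_ ^+ _ * _); case: m k {IH} => [[]//|m k] /=.
by rewrite subSn// -ltnS.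
Qed.

Lemma ar1_coefE (u : nat -> T -> R) (i : 'I_n) w :
  ar1 alpha u i.+1 w = \sum_(k < n) ar1_coef alpha i k * u k.+1 w.
Proof.
rewrite ar1E /=.
rewrite (big_ord_widen n (fun k => alpha ^+ (i - k) * u k.+1 w))//.
rewrite big_mkcond/=; apply: eq_bigr => k _.
by rewrite /ar1_coef ltnS; case: ifP; rewrite ?mul0r.
Qed.

Lemma emp_cov_ar1E a b w :
  emp_cov (ar1 alpha (innovation a)) (ar1 alpha (innovation b)) n w =
  bil (cov_mx alpha (n := n)) a b (sample innovations w).
Proof.
rewrite /emp_cov !big_add1 /= !big_mkord.
pose u c (k : 'I_n) := innovation c k.+1 w.
have -> : bil (cov_mx alpha (n := n)) a b (sample innovations w) =
    \sum_k \sum_l cov_mx alpha k l * (u a k * u b l).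
  rewrite /bil /lin; apply: eq_bigr => k _; rewrite mulr_sumr.
  by apply: eq_bigr => l _; rewrite !sampleE /u; ring.
have sumE c : \sum_(i < n) ar1 alpha (innovation c) i.+1 w = \sum_k colsum alpha k * u c k.
  under eq_bigr do rewrite ar1_coefE.
  by rewrite exchange_big/=; apply: eq_bigr => k _; rewrite -mulr_suml.
rewrite !sumE.
have -> : \sum_(i < n) ar1 alpha (innovation a) i.+1 w * ar1 alpha (innovation b) i.+1 w =
    \sum_k \sum_l gram alpha k l * (u a k * u b l).
  under eq_bigr do rewrite !ar1_coefE mulr_suml.
  rewrite exchange_big/=; apply: eq_bigr => k _.
  under eq_bigr do rewrite mulr_sumr.
  rewrite exchange_big/=; apply: eq_bigr => l _.
  by rewrite /gram mulr_suml; apply: eq_bigr => i _; rewrite /u; ring.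
rewrite mulr_suml !mulr_sumr -sumrB; apply: eq_bigr => k _.
rewrite !mulr_sumr -sumrB; apply: eq_bigr => l _.
by rewrite /cov_mx; ring.
Qed.

End ar1_quadratic.

Lemma indep_innovations d (T : measurableType d) (R : realType) (P : probability T R)
    (xi eta : nat -> {RV P >-> R}) (n : nat) :
  mutually_independent P (fun n => pair_rv (xi n.+1) (eta n.+1)) ->
  forall A : 'I_n -> set (R * R), (forall i, measurable (A i)) ->
  P (\big[setI/[set: T]]_i (innovations xi eta i @^-1` A i)) =
  (\prod_i P (innovations xi eta i @^-1` A i))%E.
Proof.
move=> indep A mA.
(* Independence is assumed for families of sets indexed by all naturals, so [A] is extended by the
   full set. *)
pose B (k : nat) : set (R * R) := oapp A setT (insub k).
have mB k : measurable (B k) by rewrite /B; case: insub => //=.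
have BE (i : 'I_n) : B i = A i by rewrite /B valK.
have := indep (index_iota 0 n) B (iota_uniq _ _) mB.
rewrite !big_mkord => h.
rewrite (eq_bigr (fun i : 'I_n => pair_rv (xi i.+1) (eta i.+1) @^-1` B i)); last first.
  by move=> i _; rewrite BE.
by rewrite h; apply: eq_bigr => i _; rewrite BE.
Qed.

Theorem theorem21 (R : realType) (alpha r : R)
    (halpha : `|alpha| < 1) (hr : 0 < `|r| < 1) :
  exists (C : R) (N : nat),
    forall (d : measure_display) (T : measurableType d) (P : probability T R)
           (xi eta : nat -> {RV P >-> R}),
      (forall n, (0 < n)%N ->
         centered_gaussian2 (corr_mx r) (distribution P (pair_rv (xi n) (eta n)))) ->
      mutually_independent P (fun n => pair_rv (xi n.+1) (eta n.+1)) ->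
      forall n, (N <= n)%N ->
        (dKol (distribution P (normalized_corr alpha r xi eta n)) (normal_prob 0 1)
         <= (C * Num.sqrt (ln n%:R / n%:R))%:E)%E.
Proof.
have /andP[_ r1] := hr.
pose b := alpha ^+ 2; pose q := (1 - `|alpha|)^-1.
have b0 : 0 <= b by exact: sqr_ge0.
have b1 : 0 < 1 - b by rewrite subr_gt0 /b -real_normK ?num_real// expr_lt1.
(* [v] is the stationary variance, and [w] is the sum over all integer lags of the squared
   stationary autocovariances. The normalizing factor is v / sqrt w, since v^2 / w = (1 - b) / (1 +
   b). *)
pose v := (1 - b)^-1; pose w := (1 + b) / (1 - b) ^+ 3.
have v0 : 0 < v by rewrite invr_gt0.
have w0 : 0 < w by rewrite divr_gt0 ?exprn_gt0// ltr_wpDr.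
have q0 : 0 <= q by rewrite invr_ge0 subr_ge0 ltW.
pose K := 2 * q ^+ 2 + 7 * q ^+ 4.
have q2 : 0 <= q ^+ 2 by exact: exprn_ge0.
have q4 : 0 <= q ^+ 4 by exact: exprn_ge0.
have [Kq2 Kq4] : 2 * q ^+ 2 <= K /\ 7 * q ^+ 4 <= K by rewrite /K; split; lra.
have K0 : 0 <= K by apply: le_trans Kq2; lra.
pose D := quad_corr_rate r v w K.
(* With z0 = sqrt (ln n), [2 * D] comes from 1 + |z| <= 2 z0 for |z| <= z0, and the extra 1 from the
   Gaussian tail beyond z0. The lower bound on [n] ensures n >= e, hence ln n >= 1 and z0 >= 1. *)
exists (2 * D + 1), (Num.trunc (expR 1 : R)).+1 => d T P xi eta gaussian indep n Nn.
have n0 : (0 < n)%N by exact: leq_trans Nn.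
have nR : 0 < n%:R :> R by rewrite ltr0n.
have ln1 : 1 <= ln n%:R :> R.
  rewrite -[leLHS]expRK ler_ln ?posrE ?expR_gt0//.
  by rewrite (le_trans (ltW (truncnS_gt _)))// ler_nat.
have rowS i : \sum_j `|cov_mx alpha (n := n) i j| <= K / n%:R.
  apply: (le_trans (sum_cov_mx halpha n0 i)).
  by rewrite ler_wpM2r// invr_ge0 ltW.
have trS : `|mxtr (cov_mx alpha (n := n)) - v| <= K / n%:R.
  apply: (le_trans (tr_cov_le halpha n0)).
  by rewrite ler_wpM2r// invr_ge0 ltW.
have sS i j : cov_mx alpha (n := n) i j = cov_mx alpha j i by exact: cov_mxC.
have trS2 : `|n%:R * mxtr (mxsq (cov_mx alpha (n := n))) - w| <= K / n%:R.
  rewrite mxtr_mxsq//; apply: (le_trans (tr_cov2_le halpha n0)).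
  by rewrite ler_wpM2r// invr_ge0 ltW.
pose s := Num.sqrt n%:R : R.
have s0 : 0 < s by rewrite sqrtr_gt0.
pose G z := fine (distribution P (normalized_corr alpha r xi eta n) `]-oo, z]).
have GE z : distribution P (normalized_corr alpha r xi eta n) `]-oo, z] = (G z)%:E.
  by rewrite /G fineK// fin_num_measure.
have mono x y : x <= y -> G x <= G y.
  move=> xy; rewrite -lee_fin -!GE; apply: le_measure; rewrite ?inE//.
  by move=> t /=; rewrite !in_itv/= => /le_trans; exact.
have G0 x : 0 <= G x by rewrite fine_ge0.
have G1 x : G x <= 1 by rewrite -lee_fin -GE probability_le1.
have sampE w' : normalized_corr alpha r xi eta n w' =
    normalized_quad_corr r (cov_mx alpha (n := n)) v w (sample (innovations xi eta (n := n)) w').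
  rewrite /normalized_corr /normalized_quad_corr /quad_corr /emp_corr.
  rewrite -!emp_cov_ar1E /=; congr (_ * _).
  have -> : Num.sqrt ((1 - alpha ^+ 2) / (1 + alpha ^+ 2)) = v / Num.sqrt w.
    rewrite -/b; have -> : (1 - b) / (1 + b) = v ^+ 2 / w.
      by rewrite /v /w; field; rewrite !gt_eqF// ltr_wpDr.
    by rewrite sqrtrM ?sqr_ge0// sqrtrV ?(ltW w0)// sqrtr_sqr gtr0_norm.
  rewrite invfM; ring.
have core z : `|G z - gausscdf z| <= D * (1 + `|z|) / s.
  apply: (quad_corr_kolmogorov r1 (indep_innovations indep) _ sS n0 v0 w0 K0 rowS trS trS2).
  - by move=> i; exact: gaussian.
  - by rewrite -[X in measurable X]setTI; apply: measurable_funP.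
  - by move=> x; rewrite /= in_itv/= sampE.
pose z0 := Num.sqrt (ln n%:R) : R.
have z01 : 1 <= z0 by rewrite -[leLHS]sqrtr1 ler_wsqrtr.
have -> : Num.sqrt (ln n%:R / n%:R) = z0 / s :> R.
  by rewrite sqrtrM ?sqrtrV// ltW// (lt_le_trans ltr01).
have D0 : 0 <= D.
  have := le_trans (normr_ge0 _) (core 0); rewrite normr0 addr0 mulr1.
  by rewrite pmulr_lge0// invr_gt0.
have moderate z : `|z| <= z0 -> `|G z - gausscdf z| <= 2 * D * (z0 / s).
  move=> zz; apply: (le_trans (core z)); rewrite [leRHS]mulrA ler_wpM2r ?invr_ge0 ?(ltW s0)//.
  by rewrite -mulrA mulrCA ler_wpM2l//; lra.
have tail : 1 - gausscdf z0 <= z0 / s.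
  have z00 : 0 < z0 by exact: lt_le_trans z01.
  have := mills_right z00; set y := 1 - gausscdf z0 => h.
  have y0 : 0 <= y by rewrite subr_ge0 gausscdf_le1.
  have : gaussd z0 <= s^-1.
    (* The cut at sqrt (ln n) is the point where exp(-z0^2 / 2) equals 1 / sqrt n. *)
    have -> : s^-1 = expR (- (z0 ^+ 2 / 2)).
      rewrite expRN sqr_sqrtr; last exact: le_trans ln1.
      congr (_^-1); apply: (@pexpIrn _ 2) => //; rewrite ?nnegrE ?expR_ge0 ?(ltW s0)//.
      rewrite sqr_sqrtr ?(ltW nR)// -expRM_natl mulrC divfK//.
      by rewrite lnK// posrE.
    have := gaussd_le1 (0 : R); rewrite !gaussdE expr0n mul0r oppr0 expR0 mulr1 => h1.
    by rewrite ler_piMl// expR_ge0.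
  have si : 0 < s^-1 by rewrite invr_gt0.
  have : y <= z0 * y by rewrite ler_peMl.
  have : s^-1 <= z0 / s by rewrite ler_peMl// ltW.
  lra.
have zs0 : 0 <= z0 / s by rewrite divr_ge0 ?ltW// (lt_le_trans ltr01).
have z0n : `|z0| <= z0 by rewrite ger0_norm// sqrtr_ge0.
have z0n' : `|- z0| <= z0 by rewrite normrN.
apply: ge_ereal_sup => _ [z _ <-].
rewrite GE normal_prob_ray -EFinB abse_EFin lee_fin.
have DD : 2 * D * (z0 / s) <= (2 * D + 1) * (z0 / s) by rewrite ler_wpM2r// lerDl.
have [zz|zz] := leP `|z| z0; first exact: le_trans (moderate _ zz) DD.
have mid : (2 * D + 1) * (z0 / s) = 2 * D * (z0 / s) + z0 / s by ring.
rewrite mid ler_norml.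
have := G0 z; have := G1 z; have := gausscdf_ge0 z; have := gausscdf_le1 z.
case: (leP 0 z) => zs.
  have zz' : z0 <= z by move: zz; rewrite ger0_norm// => /ltW.
  have := mono _ _ zz'; have := gausscdf_le zz'.
  have := moderate _ z0n; rewrite ler_norml; lra.
have zz' : z <= - z0 by move: zz; rewrite ltr0_norm// => /ltW; rewrite lerNr.
have := mono _ _ zz'; have := gausscdf_le zz'.
have := moderate _ z0n'; have := gausscdfN z0; rewrite ler_norml; lra.
Qed.
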